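(* Let $(x_e,u_e)$ be a controlled equilibrium, $V:\mathcal H\to\mathbb R$ a storage function and $\alpha\in\mathcal K$. The optimal control problem (OCP) is strictly pre-dissipative at $(x_e,u_e)$ with storage function $V$ and (continuous) dissipation rate $\alpha$ if and only if for any $x_0\in\mathcal H$, any $u\in L^2_{\rm loc}([0,\infty),\mathcal U)$, and any $0\le t_1<t_2$ one has $$V(x_u(t_2;x_0))-V(x_u(t_1;x_0))\ \le\ \int_{t_1}^{t_2}\big[\ell(x_u(t;x_0),u(t))-\ell(x_e,u_e)-\alpha(\|x_u(t;x_0)-x_e\|)\big]\,dt .$$
   Context: Setting: $\mathcal H,\mathcal U,\mathcal Y,\mathcal Z$ are Hilbert spaces (real or complex, over the same field), $A$ generates a $C_0$-semigroup $T(\cdot)$ on $\mathcal H$, and $B\in L(\mathcal U,\mathcal H)$, $C\in L(\mathcal H,\mathcal Y)$, $K\in L(\mathcal U,\mathcal Z)$ are bounded linear operators, $z\in\mathcal H$, $v\in\mathcal U$. It is assumed that there is $c_K>0$ with $\|Ku\|\ge c_K\|Bu\|$ for all $u\in\mathcal U$. The optimal control problem (OCP) is to minimize $\int_0^{T}\ell(x,u)\,dt$ over $u\in L^2(0,T;\mathcal U)$ subject to $\dot x=Ax+Bu$, $x(0)=x_0$ (with $T>0$ here the time horizon), where $\ell(x,u)=\|Cx\|^2+\|Ku\|^2+2\operatorname{Re}\langle z,x\rangle+2\operatorname{Re}\langle v,u\rangle$. The mild solution of $\dot x=Ax+Bu$, $x(0)=x_0\in\mathcal H$ is denoted $x_u(t;x_0)=T(t)x_0+\int_0^tT(t-s)Bu(s)\,ds$.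 A controlled equilibrium is a pair $(x_e,u_e)\in\operatorname{dom}A\times\mathcal U$ with $Ax_e+Bu_e=0$. $\mathcal K$ is the set of continuous strictly increasing functions $\alpha:[0,\infty)\to[0,\infty)$ with $\alpha(0)=0$. A storage function is a (Fréchet, real-linear derivative) $C^1$-function $V:\mathcal H\to\mathbb R$. The OCP is strictly pre-dissipative at a controlled equilibrium $(x_e,u_e)$ with storage function $V$ and dissipation rate $\alpha\in\mathcal K$ if for all $x\in\operatorname{dom}A$ and $u\in\mathcal U$: $V'(x)(Ax+Bu)\le\ell(x,u)-\ell(x_e,u_e)-\alpha(\|x-x_e\|)$. *)

(* Defs.v *)
From HB Require Import structures.
From mathcomp Require Import all_boot all_order all_algebra sesquilinear complex.
From mathcomp Require Import all_classical all_reals all_analysis.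

Set Implicit Arguments.
Unset Strict Implicit.
Unset Printing Implicit Defensive.

Import Order.TTheory GRing.Theory Num.Theory.
Import numFieldNormedType.Exports.

Local Open Scope classical_set_scope.
Local Open Scope ring_scope.

Variant scalar_kind := RealScalars | ComplexScalars.

Definition scalar_field (R : realType) (k : scalar_kind) : numFieldType :=
  match k with
  | RealScalars => R
  | ComplexScalars => R[i]
  end.

Section scalars.
Variables (R : realType) (k : scalar_kind).

Definition of_real : R -> scalar_field R k :=
  match k return R -> scalar_field R k with
  | RealScalars => fun a => a
  | ComplexScalars => fun a => a%:C%C
  end.

Definition real_part : scalar_field R k -> R :=
  match k return scalar_field R k -> R with
  | RealScalars => fun a => a
  | ComplexScalars => fun a => complex.Re a
  end.

Definition conjugate : scalar_field R k -> scalar_field R k :=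
  match k return scalar_field R k -> scalar_field R k with
  | RealScalars => fun a => a
  | ComplexScalars => fun a => conjc a
  end.

End scalars.

Section scalars_theory.
Variables (R : realType) (k : scalar_kind).
Local Notation F := (scalar_field R k).

Lemma of_realM (a b : R) : of_real k (a * b) = of_real k a * of_real k b.
Proof. by case: k => //=; exact: rmorphM. Qed.

Lemma of_realD (a b : R) : of_real k (a + b) = of_real k a + of_real k b.
Proof. by case: k => //=; exact: rmorphD. Qed.

Lemma of_real1 : of_real k (1 : R) = 1.
Proof. by case: k. Qed.

Lemma of_realK : cancel (@of_real R k) (@real_part R k).
Proof. by case: k. Qed.

Lemma real_partM (a : R) (b : F) :
  real_part (of_real k a * b) = a * real_part b.
Proof. by case: k b => //= -[x y] /=; rewrite mul0r subr0. Qed.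

Lemma real_partD (a b : F) : real_part (a + b) = real_part a + real_part b.
Proof. by case: k a b => //= -[x y] [z t]. Qed.

Lemma norm_of_real (a : R) : `|of_real k a| = of_real k `|a|.
Proof. by case: k => //=; rewrite normc_def /= expr0n addr0 sqrtr_sqr. Qed.

Lemma le_real_part (a b : F) : a <= b -> real_part a <= real_part b.
Proof. by case: k a b => //= -[x y] [z t]; rewrite lecE => /andP[]. Qed.

Lemma ge0_real_part (a : F) : 0 <= a -> a = of_real k (real_part a).
Proof.
by case: k a => //= -[x y]; rewrite lecE /= => /andP[/eqP ->].
Qed.

End scalars_theory.

HB.mixin Record CompleteNormedModule_isHilbert (R : realType) (k : scalar_kind)
    (H : Type) & CompleteNormedModule (scalar_field R k) H := {
  inner : {dot H for @conjugate R k} ;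
  inner_norm : forall x : H, (inner : H -> H -> _) x x = `|x| ^+ 2
}.

#[short(type="hilbertType")]
HB.structure Definition Hilbert (R : realType) (k : scalar_kind) :=
  {H of CompleteNormedModule (scalar_field R k) H
      & CompleteNormedModule_isHilbert R k H}.

(* The norm of a space over [scalar_field R k] takes its values in that field;
   [realified] has the real part of it as norm. *)
Definition realified (R : realType) (k : scalar_kind)
  (E : normedModType (scalar_field R k)) : Type := E.

Section realified.
Variables (R : realType) (k : scalar_kind).
Variable E : normedModType (scalar_field R k).
Local Notation ER := (realified E).

HB.instance Definition _ := GRing.Zmodule.on ER.

Let scale (a : R) (x : ER) : ER := (of_real k a *: (x : E) : E).

Let scaleA a b x : scale a (scale b x) = scale (a * b) x.
Proof. by rewrite /scale scalerA of_realM. Qed.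
Let scale1 : left_id 1 scale.
Proof. by move=> x; rewrite /scale of_real1 scale1r. Qed.
Let scaleDr : right_distributive scale +%R.
Proof. by move=> a x y; rewrite /scale; exact: scalerDr. Qed.
Let scaleDl x : {morph scale^~ x : a b / a + b}.
Proof. by move=> a b; rewrite /scale of_realD; exact: scalerDl. Qed.

HB.instance Definition _ :=
  GRing.Zmodule_isLmodule.Build R ER scaleA scale1 scaleDr scaleDl.

Let norm (x : ER) : R := real_part `|x : E|.

Let normD x y : norm (x + y) <= norm x + norm y.
Proof.
by rewrite /norm -real_partD; apply: le_real_part; exact: ler_normD.
Qed.
Let normZ a x : norm (a *: x) = `|a| * norm x.
Proof.
by rewrite /norm [a *: x]/(scale a x) /scale normrZ norm_of_real real_partM.
Qed.
Let norm0_eq0 x : norm x = 0 -> x = 0.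
Proof.
move=> x0; apply: (@normr0_eq0 _ E).
by rewrite (ge0_real_part (normr_ge0 _)) [real_part _]x0; case: (k).
Qed.

HB.instance Definition _ := Lmodule_isNormed.Build R ER normD normZ norm0_eq0.

End realified.

Definition rnorm (R : realType) (k : scalar_kind)
  (E : normedModType (scalar_field R k)) (x : E) : R := `|x : realified E|.

Definition bounded_operator (R : realType) (k : scalar_kind)
  (E F : normedModType (scalar_field R k)) (f : {linear E -> F}) :=
  exists M : R, forall x, rnorm (f x) <= M * rnorm x.

Section bochner.
Context d (T : measurableType d) (R : realType).
Variables (mu : {measure set T -> \bar R}) (E : normedModType R).

(* The function equal to the sum of the [step_val i] times the indicators of
   the [step_set i], which may overlap. *)
Record step_map := StepMap {
  step_size : nat ;
  step_set : 'I_step_size -> set T ;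
  step_val : 'I_step_size -> E ;
  step_measurable : forall i, measurable (step_set i) ;
  step_finite : forall i, (mu (step_set i) < +oo)%E
}.

Definition step_eval (s : step_map) (x : T) : E :=
  \sum_(i < step_size s) (\1_(step_set i) x : R) *: step_val i.

Definition step_integral (D : set T) (s : step_map) : E :=
  \sum_(i < step_size s) fine (mu (D `&` step_set i)) *: step_val i.

Definition ae_limit (D : set T) (s : nat -> step_map) (f : T -> E) :=
  {ae mu, forall x, D x -> step_eval (s n) x @[n --> \oo] --> f x}.

Definition strongly_measurable (D : set T) (f : T -> E) :=
  exists s : nat -> step_map, ae_limit D s f.

Definition is_bochner_integral (D : set T) (f : T -> E) (y : E) :=
  exists s : nat -> step_map,
    [/\ ae_limit D s f,
        (\int[mu]_(x in D) (`|f x - step_eval (s n) x|)%:E)%E @[n --> \oo]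
          --> 0%E
      & step_integral D (s n) @[n --> \oo] --> y].

(* The value is 0 if [f] is not Bochner integrable on [D]. *)
Definition bochner_integral (D : set T) (f : T -> E) : E :=
  xget 0 [set y | is_bochner_integral D f y].

End bochner.

(* [u] is a representative of a class in L^2_loc([0, +oo[, U); its values on
   the negative half-line are irrelevant. *)
Definition L2_loc (R : realType) (k : scalar_kind)
    (U : normedModType (scalar_field R k)) (u : R -> U) :=
  strongly_measurable (E := realified U) lebesgue_measure `[0, +oo[ u /\
  forall b : R, (\int[lebesgue_measure]_(t in `[0%R, b])
    ((rnorm (u t) ^+ 2)%:E) < +oo)%E.

Section control.
Variables (R : realType) (k : scalar_kind) (H U Y Z : hilbertType R k).

(* Only the values of [S] on [0, +oo[ are relevant. *)
Definition C0_semigroup (S : R -> {linear H -> H}) :=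
  [/\ forall t, 0 <= t -> bounded_operator (S t),
      forall x, S 0 x = x,
      forall s t, 0 <= s -> 0 <= t -> forall x, S (s + t) x = S s (S t x)
    & forall x : H, (S t x : realified H) @[t --> 0^'+] --> (x : realified H)].

Definition difference_quotient (S : R -> {linear H -> H}) (x : H) (t : R)
  : realified H := t^-1 *: ((S t x - x : H) : realified H).

(* The values of [A] outside of [domA] are irrelevant. *)
Definition generates (domA : set H) (A : H -> H) (S : R -> {linear H -> H}) :=
  domA = [set x | cvg (difference_quotient S x t @[t --> 0^'+])] /\
  forall x, domA x ->
    difference_quotient S x t @[t --> 0^'+] --> (A x : realified H).

Definition mild_solution (S : R -> {linear H -> H}) (B : {linear U -> H})
    (x0 : H) (u : R -> U) (t : R) : H :=
  S t x0 + bochner_integral (E := realified H) lebesgue_measure `[0, t]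
             (fun s => S (t - s) (B (u s))).

Definition controlled_equilibrium (domA : set H) (A : H -> H)
    (B : {linear U -> H}) (xe : H) (ue : U) :=
  domA xe /\ A xe + B ue = 0.

Definition running_cost (C : {linear H -> Y}) (K : {linear U -> Z})
    (z : H) (v : U) (x : H) (u : U) : R :=
  rnorm (C x) ^+ 2 + rnorm (K u) ^+ 2
  + 2 * real_part ((inner : {dot H for _}) z x)
  + 2 * real_part ((inner : {dot U for _}) v u).

Definition classK (alpha : R -> R) :=
  [/\ {within `[0, +oo[, continuous alpha},
      {in `[0, +oo[ &, {homo alpha : r s / r < s}}
    & alpha 0 = 0].

(* [V] has domain [realified H], so that ['d V] is the real-linear Frechet
   derivative even when the scalars are complex. *)
Definition storage_function (V : realified H -> R) :=
  (forall x, differentiable V x) /\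
  (* ['d V] is continuous for the operator norm *)
  forall (x : realified H) (e : R), 0 < e ->
    \forall y \near x, forall h, `|'d V y h - 'd V x h| <= e * `|h|.

Definition strictly_pre_dissipative (domA : set H) (A : H -> H)
    (B : {linear U -> H}) (l : H -> U -> R) (xe : H) (ue : U)
    (V : realified H -> R) (alpha : R -> R) :=
  forall (x : H) (u : U), domA x ->
    'd V (x : realified H) (A x + B u) <= l x u - l xe ue - alpha (rnorm (x - xe)).

End control.

(* Main.v *)
Require Import Defs.
From HB Require Import structures.
From mathcomp Require Import all_boot all_order all_algebra sesquilinear complex.
From mathcomp Require Import all_classical all_reals all_analysis.
From mathcomp Require Import measurable_realfun ring lra.

(** Write [x] for the mild solution, [T] for the semigroup and [l] for the
    supply rate of the dissipation inequality, that is, the running cost minus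
    its value at the equilibrium minus the dissipation rate.

    The integral inequality implies the pointwise one because, for an initial
    state [x0] in [dom A] and a constant control [w], the mild solution has at
    time 0 the right derivative [A x0 + B w].  Divided by [h], the inequality
    on [0, h] tends to the pointwise inequality at [x0] and [w]
    ([pointwise_dissipation]).

    Conversely, the pointwise inequality bounds the right derivative of
    [V (x t)] wherever [x t] is in [dom A].  This is the case at all times if
    [x0] is in [dom A] and the control is constant on the cells of a uniform
    grid: within a cell, [x (a + h)] is the sum of [T h (x a)] and of the
    integral over [0, h] of [T (h - s) (B w)], and both stay in [dom A].  Then
    [V (x t)] minus the integral of [l] up to [t] is a continuous function
    whose right derivative exists and is nonpositive at every time, so it is
    nonincreasing ([dini_nonincreasing], [grid_dissipation]).  Looking at right
    derivatives only, the jumps of the control do no harm.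
    Finally [dom A] is dense ([in_generator_dense]), the grid controls are
    dense in L2 on bounded intervals ([L2_grid_sequence]), the solution depends
    on both uniformly in time ([mild_norm]), and both sides of the inequality
    pass to the limit ([L2_dissipation]).

    The argument takes place in real Hilbert spaces: a complex space is replaced
    by its realification, with the real part of the inner product.  A Bochner
    integral is characterized there by its inner products with all vectors,
    each of which is a Lebesgue integral of a real function
    ([weak_integral], [bochnerP]); the norm estimate, the additivity in the
    domain and the translation of integrals are read off from real integrals.
    The approximation by step maps enters only in the existence of the integral
    and in its commutation with bounded operators
    ([bochner_integral_ex], [bochner_integral_linear]).

    A locally square integrable control is a limit of step maps only almost
    everywhere, so that the functions to integrate may fail to be Borel.
    The control is therefore first replaced by a representative which is a
    limit everywhere ([L2_loc_representative]); all the integrals stay the same,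
    because integrals of arbitrary functions ignore null sets
    ([integral_off_null]). *)

Set Implicit Arguments.
Unset Strict Implicit.
Unset Printing Implicit Defensive.

Import Order.TTheory GRing.Theory Num.Theory.
Import numFieldNormedType.Exports.

Local Open Scope classical_set_scope.
Local Open Scope ring_scope.

(** * Step maps and their pointwise limits *)
Section step_maps.
Context d (T : measurableType d) (R : realType).
Variable mu : {measure set T -> \bar R}.
Variable E : normedModType R.

Definition step_of (I : finType) (A : I -> set T) (w : I -> E)
    (mA : forall i, measurable (A i)) (fA : forall i, (mu (A i) < +oo)%E) :
    step_map mu E :=
  @StepMap _ _ _ mu E #|I| (fun i => A (enum_val i)) (fun i => w (enum_val i))
    (fun i => mA (enum_val i)) (fun i => fA (enum_val i)).

Lemma step_ofE (I : finType) (A : I -> set T) (w : I -> E) mA fA x :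
  step_eval (@step_of I A w mA fA) x = \sum_i (\1_(A i) x : R) *: w i.
Proof.
by rewrite [RHS](reindex _ (onW_bij _ (enum_val_bij I))).
Qed.

(** Splitting off one index turns the function into a combination of two
    translated copies of the remaining one, weighted by the indicators of a set
    and of its complement; the induction thus runs over all translations [e]. *)
Lemma measurable_comp_indic_sum (phi : E -> R) (I : Type) (r : seq I)
    (A : I -> set T) (w : I -> E) : (forall i, measurable (A i)) ->
  forall e, measurable_fun setT
    (fun x => phi (e + \sum_(i <- r) (\1_(A i) x : R) *: w i)).
Proof.
move=> mA; elim: r => [|i r IH] e.
  by under eq_fun do rewrite big_nil; exact: measurable_cst.
rewrite [X in measurable_fun _ X](_ : _ = (fun x =>
    (\1_(A i) x * phi ((e + w i) + \sum_(j <- r) (\1_(A j) x : R) *: w j)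
    + (1 - \1_(A i) x)
       * phi (e + \sum_(j <- r) (\1_(A j) x : R) *: w j)))); last first.
  apply/funext => x; rewrite big_cons indicE; case: (x \in A i) => /=.
    by rewrite scale1r mul1r subrr mul0r addr0 addrA.
  by rewrite scale0r add0r mul0r subr0 mul1r add0r.
apply: measurable_funD; apply: measurable_funM => //.
apply: measurable_funB => //.
Qed.

Lemma measurable_comp_step (phi : E -> R) (s : step_map mu E) :
  measurable_fun setT (fun x => phi (step_eval s x)).
Proof.
have := measurable_comp_indic_sum phi (index_enum _) (@step_val _ _ _ _ _ s)
  (@step_measurable _ _ _ _ _ s) 0.
by under eq_fun do rewrite add0r.
Qed.

Lemma step_add (s1 s2 : step_map mu E) :
  {s : step_map mu E | forall x, step_eval s x = step_eval s1 x + step_eval s2 x}.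
Proof.
pose A (i : 'I_(step_size s1) + 'I_(step_size s2)) : set T := match i with
  inl i => step_set i | inr i => step_set i end.
pose w (i : 'I_(step_size s1) + 'I_(step_size s2)) : E := match i with
  inl i => step_val i | inr i => step_val i end.
have mA i : measurable (A i) by case: i => i; exact: step_measurable.
have fA i : (mu (A i) < +oo)%E by case: i => i; exact: step_finite.
by exists (step_of w mA fA) => x; rewrite step_ofE big_sumType.
Qed.

Lemma step_restrict (s : step_map mu E) (B : set T) : measurable B ->
  {s' : step_map mu E |
    forall x, step_eval s' x = (\1_B x : R) *: step_eval s x}.
Proof.
move=> mB; pose A (i : 'I_(step_size s)) := step_set i `&` B.
have mA (i : 'I_(step_size s)) : measurable (A i).
  by apply: measurableI => //; exact: step_measurable.
have fA (i : 'I_(step_size s)) : (mu (A i) < +oo)%E.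
  apply: le_lt_trans (step_finite i); apply: le_measure; rewrite ?inE.
  - exact: mA.
  - exact: step_measurable.
  - by move=> x [].
exists (step_of (@step_val _ _ _ _ _ s) mA fA) => x.
rewrite step_ofE /step_eval scaler_sumr; apply: eq_bigr => i _.
by rewrite scalerA indicI /= mulrC.
Qed.

(** Strong measurability with a limit at every point of [D]: the composition
    with a continuous function is then measurable, which may fail for a limit
    almost everywhere when the sigma-algebra is not complete. *)
Definition step_limit (D : set T) (f : T -> E) :=
  exists s : nat -> step_map mu E,
    forall x, D x -> step_eval (s n) x @[n --> \oo] --> f x.

Lemma measurable_comp_step_limit (D : set T) f (phi : E -> R) :
  measurable D -> step_limit D f -> continuous phi ->
  measurable_fun D (phi \o f).
Proof.
move=> mD [s sf] cphi.
apply: (@measurable_fun_cvg _ _ _ _ (fun n x => phi (step_eval (s n) x))) => //.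
  by move=> n; apply: measurable_funTS; exact: measurable_comp_step.
move=> x Dx; apply: continuous_cvg; [exact: cphi|exact: sf].
Qed.

Lemma step_limit_norm D f : measurable D -> step_limit D f ->
  measurable_fun D (fun x => `|f x|).
Proof.
move=> mD sf; apply: (measurable_comp_step_limit (phi := Num.norm)) => //.
exact: norm_continuous.
Qed.

Lemma step_limitD D f g : step_limit D f -> step_limit D g ->
  step_limit D (fun x => f x + g x).
Proof.
move=> [s sf] [s' sg].
exists (fun n => sval (step_add (s n) (s' n))) => x Dx.
under eq_cvg do rewrite (svalP (step_add _ _)).
by apply: cvgD; [exact: sf|exact: sg].
Qed.

Lemma step_limit_restrict D B f : measurable B -> step_limit (D `&` B) f ->
  step_limit D (fun x => (\1_B x : R) *: f x).
Proof.
move=> mB [s sf].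
exists (fun n => sval (step_restrict (s n) mB)) => x Dx.
have [xB|xB] := boolP (x \in B).
  under eq_cvg do rewrite (svalP (step_restrict _ _)).
  by apply: cvgZr; apply: sf; split => //; exact: set_mem.
under eq_cvg do rewrite (svalP (step_restrict _ _)) indicE (negbTE xB) scale0r.
by rewrite indicE (negbTE xB) scale0r; exact: cvg_cst.
Qed.

Lemma step_limitS D D' f : D' `<=` D -> step_limit D f -> step_limit D' f.
Proof. by move=> D'D [s sf]; exists s => x /D'D; exact: sf. Qed.

Lemma step_limit_eq D f g : (forall x, D x -> f x = g x) ->
  step_limit D f -> step_limit D g.
Proof.
by move=> fg [s sf]; exists s => x Dx; rewrite -fg//; exact: sf.
Qed.

Lemma step_limit_step D (s : step_map mu E) : step_limit D (step_eval s).
Proof. by exists (fun=> s) => x _; exact: cvg_cst. Qed.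

End step_maps.

Lemma step_map_linear d (T : measurableType d) (R : realType)
    (mu : {measure set T -> \bar R}) (E F : normedModType R)
    (L : {linear E -> F}) (s : step_map mu E) :
  {s' : step_map mu F |
    (forall x, step_eval s' x = L (step_eval s x)) /\
    (forall D, step_integral D s' = L (step_integral D s))}.
Proof.
exists (@StepMap _ _ _ mu F (step_size s) (@step_set _ _ _ _ _ s)
  (fun i => L (step_val i)) (@step_measurable _ _ _ _ _ s)
  (@step_finite _ _ _ _ _ s)).
split=> [x|D]; rewrite /step_eval /step_integral/= linear_sum;
  by apply: eq_bigr => i _; rewrite linearZ.
Qed.

Lemma step_limit_linear d (T : measurableType d) (R : realType)
    (mu : {measure set T -> \bar R}) (E F : normedModType R)
    (L : {linear E -> F}) D (f : T -> E) : continuous L ->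
  step_limit mu D f -> step_limit mu D (L \o f).
Proof.
move=> cL [s sf].
exists (fun n => sval (step_map_linear L (s n))) => x Dx.
under eq_cvg do rewrite (svalP (step_map_linear _ _)).1.
by apply: continuous_cvg; [exact: cL|exact: sf].
Qed.

(** * Lebesgue integrals of real functions *)
Section real_integral_lemmas.
Context d (T : measurableType d) (R : realType).
Variable mu : {measure set T -> \bar R}.
Implicit Types (D : set T) (f g : T -> R).

Lemma ge0_integrable D f : measurable_fun D f ->
  (forall x, D x -> 0 <= f x) -> (\int[mu]_(x in D) (f x)%:E < +oo)%E ->
  mu.-integrable D (EFin \o f).
Proof.
move=> mf f0 foo; apply/integrableP; split; first exact/measurable_EFinP.
rewrite (eq_integral (fun x => (f x)%:E))// => x /set_mem Dx /=.
by rewrite ger0_norm// f0.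
Qed.

Lemma le_integrable_real D f g : measurable D -> measurable_fun D f ->
  (forall x, D x -> `|f x| <= g x) -> mu.-integrable D (EFin \o g) ->
  mu.-integrable D (EFin \o f).
Proof.
move=> mD mf fg; apply: le_integrable => //; first exact/measurable_EFinP.
by move=> x Dx /=; rewrite lee_fin (le_trans (fg _ Dx))// ler_norm.
Qed.

Lemma integrable_realD D f g : measurable D ->
  mu.-integrable D (EFin \o f) -> mu.-integrable D (EFin \o g) ->
  mu.-integrable D (EFin \o (fun x => f x + g x)).
Proof. by move=> mD; exact: integrableD. Qed.

Lemma integrable_realB D f g : measurable D ->
  mu.-integrable D (EFin \o f) -> mu.-integrable D (EFin \o g) ->
  mu.-integrable D (EFin \o (fun x => f x - g x)).
Proof. by move=> mD; exact: integrableB. Qed.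

Lemma integrable_realZ D (a : R) f : measurable D ->
  mu.-integrable D (EFin \o f) -> mu.-integrable D (EFin \o (fun x => a * f x)).
Proof. by move=> mD fi; exact: (integrableZl mD a fi). Qed.

Lemma integrable_measurable D f : mu.-integrable D (EFin \o f) ->
  measurable_fun D f.
Proof. by move=> /measurable_int/measurable_EFinP. Qed.

Lemma Rintegral_fin D f : mu.-integrable D (EFin \o f) -> measurable D ->
  (\int[mu]_(x in D) (f x)%:E = (\int[mu]_(x in D) f x)%:E)%E.
Proof. by move=> fi mD; rewrite /Rintegral fineK//; exact: integrable_fin_num. Qed.

Lemma Rdominated_convergence D (f_ : nat -> T -> R) f g : measurable D ->
  (forall n, measurable_fun D (f_ n)) ->
  (forall x, D x -> f_ n x @[n --> \oo] --> f x) ->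
  mu.-integrable D (EFin \o g) ->
  (forall n x, D x -> `|f_ n x| <= g x) ->
  mu.-integrable D (EFin \o f) /\
  \int[mu]_(x in D) f_ n x @[n --> \oo] --> \int[mu]_(x in D) f x.
Proof.
move=> mD mf_ f_f ig fg.
have mf : measurable_fun D f by apply: (@measurable_fun_cvg _ _ _ _ f_).
have [] := @dominated_convergence _ _ _ mu D mD (fun n => EFin \o f_ n)
  (EFin \o f) (EFin \o g).
- by move=> n; exact/measurable_EFinP.
- exact/measurable_EFinP.
- apply: aeW => x Dx; apply: cvg_EFin; last exact: f_f.
  by apply: nearW.
- exact: ig.
- by apply: aeW => x n Dx; rewrite /= lee_fin fg.
move=> fi _ cv; split => //.
by apply: fine_cvg; rewrite -Rintegral_fin.
Qed.

Lemma Rdominated_cvg0_ae D (N : set T) (f_ : nat -> T -> R) g :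
  measurable D -> measurable N -> mu N = 0%E ->
  (forall n, measurable_fun D (f_ n)) ->
  (forall x, D x -> ~ N x -> f_ n x @[n --> \oo] --> (0 : R)) ->
  mu.-integrable D (EFin \o g) ->
  (forall n x, D x -> `|f_ n x| <= g x) ->
  \int[mu]_(x in D) f_ n x @[n --> \oo] --> (0 : R).
Proof.
move=> mD mN N0 mf_ f_f ig fg.
have [] := @dominated_convergence _ _ _ mu D mD (fun n => EFin \o f_ n)
  (EFin \o cst 0) (EFin \o g).
- by move=> n; exact/measurable_EFinP.
- exact/measurable_EFinP.
- exists N; split => // x /=; apply: contra_notP => Nx Dx.
  by apply: cvg_EFin; last exact: f_f; apply: nearW.
- exact: ig.
- by apply: aeW => x n Dx; rewrite /= lee_fin fg.
move=> _ _; rewrite integral0_eq// => cv.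
exact: (fine_cvg cv).
Qed.

Lemma Rintegral_indic_sum D (I : Type) (r : seq I) (A : I -> set T) (c : I -> R) :
  measurable D -> (forall i, measurable (A i)) ->
  (forall i, (mu (A i) < +oo)%E) ->
  mu.-integrable D (EFin \o (fun x => \sum_(i <- r) \1_(A i) x * c i)) /\
  \int[mu]_(x in D) (\sum_(i <- r) \1_(A i) x * c i)
  = \sum_(i <- r) fine (mu (D `&` A i)) * c i.
Proof.
move=> mD mA fA; elim: r => [|i r [IH1 IH2]].
  under [X in EFin \o X]eq_fun do rewrite big_nil.
  under eq_Rintegral do rewrite big_nil.
  by rewrite Rintegral_cst// mul0r big_nil; split => //; exact: integrable0.
have i1 : mu.-integrable D (EFin \o (\1_(A i) : T -> R)).
  apply: ge0_integrable => //.
  rewrite integral_indic//; apply: le_lt_trans (fA i).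
  by apply: le_measure; rewrite ?inE//; exact: measurableI.
have ic : mu.-integrable D (EFin \o (fun x => \1_(A i) x * c i)).
  by under eq_fun do rewrite mulrC; exact: integrable_realZ.
under [X in EFin \o X]eq_fun do rewrite big_cons.
split; first exact: integrable_realD.
under eq_Rintegral do rewrite big_cons.
rewrite RintegralD// IH2 big_cons RintegralZr//; congr (_ * _ + _).
by rewrite /Rintegral integral_indic// setIC.
Qed.

Lemma bounded_integrable D f (c : R) : measurable D -> (mu D < +oo)%E ->
  measurable_fun D f -> (forall x, D x -> `|f x| <= c) ->
  mu.-integrable D (EFin \o f).
Proof.
move=> mD fD mf fc; apply: measurable_bounded_integrable => //.
exists c; split; first exact: num_real.
by move=> e ce x Dx; apply: le_trans (fc x Dx) _; exact: ltW.
Qed.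

End real_integral_lemmas.

(** * Real inner products and weak integrals *)
Record real_inner_product (R : realType) (E : normedModType R) :=
  RealInnerProduct {
    ip :> E -> E -> R ;
    ipDl : forall x y z, ip (x + y) z = ip x z + ip y z ;
    ipZl : forall a x y, ip (a *: x) y = a * ip x y ;
    ipC : forall x y, ip x y = ip y x ;
    ipxx : forall x, ip x x = `|x| ^+ 2 }.

Section real_inner_product_theory.
Variables (R : realType) (E : normedModType R) (P : real_inner_product E).

Lemma ipDr x y z : P x (y + z) = P x y + P x z.
Proof. by rewrite ipC ipDl !(ipC _ _ x). Qed.

Lemma ipZr a x y : P x (a *: y) = a * P x y.
Proof. by rewrite ipC ipZl ipC. Qed.

Lemma ipNr x y : P x (- y) = - P x y.
Proof. by rewrite -scaleN1r ipZr mulN1r. Qed.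

Lemma ipBr x y z : P x (y - z) = P x y - P x z.
Proof. by rewrite ipDr ipNr. Qed.

Lemma ip0r x : P x 0 = 0.
Proof. by rewrite -(scale0r 0) ipZr mul0r. Qed.

Lemma ip_sumr (I : Type) (r : seq I) (F : I -> E) x :
  P x (\sum_(i <- r) F i) = \sum_(i <- r) P x (F i).
Proof.
by elim: r => [|i r IH]; rewrite ?big_nil ?ip0r// !big_cons ipDr IH.
Qed.

(** Cauchy-Schwarz, obtained by expanding the square of the triangle
    inequality. *)
Lemma ip_le x y : P x y <= `|x| * `|y|.
Proof.
have := ler_normD x y; rewrite -(ler_pXn2r (ltn0Sn 1)) ?nnegrE ?addr_ge0//.
rewrite -(ipxx P) ipDl !ipDr !ipxx (ipC _ y) sqrrD => h; lra.
Qed.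

Lemma norm_ip_le x y : `|P x y| <= `|x| * `|y|.
Proof.
by rewrite ler_norml ip_le andbT lerNl -ipNr (le_trans (ip_le _ _))// normrN.
Qed.

Lemma ip_continuous x : continuous (P x).
Proof.
move=> y; apply/cvgrPdist_le => e e0; near=> z.
rewrite -ipBr (le_trans (norm_ip_le _ _))//.
have : `|y - z| <= e / (`|x| + 1).
  by near: z; apply: cvgr_dist_le => //; rewrite divr_gt0// ltr_wpDl.
rewrite ler_pdivlMr ?ltr_wpDl// => /(le_trans _); apply.
by rewrite mulrC ler_wpM2l// lerDl.
Unshelve. all: by end_near. Qed.

Lemma ip_inj x y : (forall h, P h x = P h y) -> x = y.
Proof.
move=> xy; apply/eqP; rewrite -subr_eq0 -normr_eq0 -sqrf_eq0 -(ipxx P).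
by rewrite ipBr xy subrr.
Qed.

End real_inner_product_theory.

Section bochner_theory.
Context d (T : measurableType d) (R : realType).
Variable mu : {measure set T -> \bar R}.

(** The Pettis integral: [y] is determined by its inner products, which turns
    identities between vector integrals into identities between real ones. *)
Definition weak_integral (E : normedModType R) (P : real_inner_product E)
    (D : set T) (f : T -> E) (y : E) := forall h,
  mu.-integrable D (EFin \o (fun x => P h (f x))) /\
  \int[mu]_(x in D) P h (f x) = P h y.

(** The functions to which [bochnerP] applies. *)
Definition bochner_class (E : normedModType R) (D : set T) (f : T -> E) :=
  step_limit mu D f /\ mu.-integrable D (EFin \o (fun x => `|f x|)).

Lemma weak_integral_unique (E : normedModType R) (P : real_inner_product E)
    D f y y' : weak_integral P D f y -> weak_integral P D f y' -> y = y'.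
Proof. by move=> fy fy'; apply: (ip_inj (P := P)) => h; rewrite -(fy h).2 (fy' h).2. Qed.

Lemma weak_integralB (E : normedModType R) (P : real_inner_product E)
    D f g y z : measurable D ->
  weak_integral P D f y -> weak_integral P D g z ->
  weak_integral P D (fun x => f x - g x) (y - z).
Proof.
move=> mD fy gz h; have [fi fe] := fy h; have [gi ge] := gz h.
under [X in EFin \o X]eq_fun do rewrite ipBr.
under eq_Rintegral do rewrite ipBr.
by split; [exact: integrable_realB|rewrite RintegralB// fe ge ipBr].
Qed.

(** Tested against [y] itself, the integral gives the square of the norm of [y],
    and the integrand is at most [`|y| * g x]. *)
Lemma weak_integral_norm (E : normedModType R) (P : real_inner_product E)
    D f y g : measurable D -> weak_integral P D f y ->
  mu.-integrable D (EFin \o g) -> (forall x, D x -> `|f x| <= g x) ->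
  `|y| <= \int[mu]_(x in D) g x.
Proof.
move=> mD fy gi fg; have [fi fe] := fy y.
have [->|y0] := eqVneq y 0.
  rewrite normr0; apply: Rintegral_ge0 => x Dx.
  by rewrite (le_trans _ (fg x Dx)).
rewrite -(ler_pM2l (_ : 0 < `|y|)) ?normr_gt0// -expr2 -(ipxx P) -fe.
rewrite -RintegralZl//; apply: le_Rintegral => //; first exact: integrable_realZ.
move=> x Dx; rewrite (le_trans (ip_le _ _ _))// ler_wpM2l//; exact: fg.
Qed.

Lemma step_weak_integral (E : normedModType R) (P : real_inner_product E)
    D (s : step_map mu E) : measurable D ->
  weak_integral P D (step_eval s) (step_integral D s).
Proof.
move=> mD h; have [i1 i2] := @Rintegral_indic_sum _ _ _ mu D _ (index_enum _)
  (@step_set _ _ _ _ _ s) (fun i => P h (step_val i)) mD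
  (@step_measurable _ _ _ _ _ s) (@step_finite _ _ _ _ _ s).
have E1 x : P h (step_eval s x) =
    \sum_(i < step_size s) \1_(step_set i) x * P h (step_val i).
  by rewrite /step_eval ip_sumr; apply: eq_bigr => i _; rewrite ipZr.
under [X in EFin \o X]eq_fun do rewrite E1.
under eq_Rintegral do rewrite E1.
split; [exact: i1|rewrite i2 /step_integral ip_sumr].
by apply: eq_bigr => i _; rewrite ipZr.
Qed.

Lemma step_limitZ (E : normedModType R) a D (f : T -> E) :
  step_limit mu D f -> step_limit mu D (fun x => a *: f x).
Proof. by apply: (step_limit_linear (L := *:%R a)); exact: scaler_continuous. Qed.

Lemma step_limitB (E : normedModType R) D (f g : T -> E) :
  step_limit mu D f -> step_limit mu D g ->
  step_limit mu D (fun x => f x - g x).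
Proof.
move=> lf lg; apply: step_limitD => //.
by apply: step_limit_eq (step_limitZ (-1) lg) => x _; rewrite scaleN1r.
Qed.

End bochner_theory.

(** * The Bochner integral *)
Section integral_off_null_set.
Context d (T : measurableType d) (R : realType).
Variable mu : {measure set T -> \bar R}.
Local Open Scope ereal_scope.
Import HBNNSimple.

(** The integral of a nonnegative function is by definition a supremum over the
    simple functions below it, and restricting a simple function to the
    complement of [N] does not change its integral. *)
Lemma le_ge0_integral_off_null (N : set T) (f g : T -> \bar R) :
  measurable N -> mu N = 0 ->
  (forall x, 0 <= f x) -> (forall x, 0 <= g x) ->
  (forall x, ~ N x -> f x = g x) -> \int[mu]_x f x <= \int[mu]_x g x.
Proof.
move=> mN N0 f0 g0 fg; rewrite ge0_integralTE// ge0_integralTE//.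
apply: ge_ereal_sup => _ [h hf <-].
pose h' : {nnsfun T >-> R} := proj_nnsfun h (measurableC mN).
have h'E x : h' x = (h x * (x \in ~` N)%:R)%R by rewrite /h' /= mindicE.
have -> : sintegral mu h = sintegral mu h'.
  rewrite -!integralT_nnsfun; apply: ae_eq_integral => //.
  - exact/measurable_EFinP.
  - exact/measurable_EFinP.
  - exists N; split => // x /=; apply: contra_notP => Nx _.
    by rewrite mindicE mem_set// mulr1.
apply: ereal_sup_ubound; exists h' => // x; rewrite h'E.
have [/set_mem/= xN|_] := boolP (x \in _); first by rewrite mulr1 -fg.
by rewrite mulr0.
Qed.

Lemma integral_off_null (N D : set T) (f g : T -> \bar R) :
  measurable N -> mu N = 0 ->
  (forall x, D x -> ~ N x -> f x = g x) ->
  \int[mu]_(x in D) f x = \int[mu]_(x in D) g x.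
Proof.
move=> mN N0 fg; rewrite integral_mkcond [RHS]integral_mkcond.
have fg' x : ~ N x -> (f \_ D) x = (g \_ D) x.
  by move=> Nx; rewrite !patchE; case: ifPn => // /set_mem Dx; exact: fg.
have le (f' g' : T -> \bar R) : (forall x, ~ N x -> f' x = g' x) ->
    (forall x, 0 <= f' x) -> (forall x, 0 <= g' x) ->
    \int[mu]_x f' x = \int[mu]_x g' x.
  move=> f'g' f'0 g'0; apply/eqP; rewrite eq_le.
  by rewrite !(le_ge0_integral_off_null mN)// => x Nx; rewrite f'g'.
rewrite integralE [RHS]integralE; congr (_ - _); apply: le => // x Nx.
- by rewrite !funeposE fg'.
- by rewrite !funenegE fg'.
Qed.

End integral_off_null_set.

Section bochner_off_null.
Context d (T : measurableType d) (R : realType).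
Variable mu : {measure set T -> \bar R}.

Lemma is_bochner_integral_off_null (E : normedModType R) (N D : set T)
    (f g : T -> E) y : measurable N -> mu N = 0%E ->
  (forall x, D x -> ~ N x -> f x = g x) ->
  is_bochner_integral mu D f y -> is_bochner_integral mu D g y.
Proof.
move=> mN N0 fg [s [[N' [mN' N'0 sf]] s1 s2]]; exists s; split => //.
- exists (N `|` N'); split; first exact: measurableU.
    by rewrite null_set_setU.
  move=> x /=; apply: contra_notP => /not_orP[Nx N'x] Dx.
  by rewrite -fg//; move: Dx; apply: contrapT => h; apply: N'x; exact: sf.
- rewrite (_ : (fun n => _) = (fun n =>
    (\int[mu]_(x in D) (`|f x - step_eval (s n) x|)%:E)%E))//.
  apply/funext => n; apply: (integral_off_null mN) => // x Dx Nx.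
  by rewrite fg.
Qed.

Lemma bochner_integral_off_null (E : normedModType R) (N D : set T)
    (f g : T -> E) : measurable N -> mu N = 0%E ->
  (forall x, D x -> ~ N x -> f x = g x) ->
  bochner_integral mu D f = bochner_integral mu D g.
Proof.
move=> mN N0 fg; congr (xget 0 _); apply/seteqP; split => y /=;
  apply: (is_bochner_integral_off_null mN) => // x Dx Nx; rewrite fg//.
Qed.

Lemma eq_bochner_integral (E : normedModType R) (D : set T) (f g : T -> E) :
  (forall x, D x -> f x = g x) ->
  bochner_integral mu D f = bochner_integral mu D g.
Proof.
by move=> fg; apply: (@bochner_integral_off_null _ set0) => // x Dx _; exact: fg.
Qed.

(** By Cauchy-Schwarz, convergence in L1 of the step maps to [f] implies
    convergence in L1 of their inner products with [h]. *)
Lemma bochner_weak_integral (E : normedModType R) (P : real_inner_product E)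
    D (f : T -> E) y : measurable D -> step_limit mu D f ->
  is_bochner_integral mu D f y -> weak_integral mu P D f y.
Proof.
move=> mD lf [s [_ s1 s2]] h.
pose e n x := `|f x - step_eval (s n) x|.
have me n : measurable_fun D (e n).
  apply: (step_limit_norm (mu := mu)) => //; apply: step_limitB => //.
  exact: step_limit_step.
have /fine_cvgP[fin_e cvg_e] := s1.
have ie : \forall n \near \oo, mu.-integrable D (EFin \o e n).
  near=> n; apply: ge0_integrable => //; first by move=> x _; exact: normr_ge0.
  have : (\int[mu]_(x in D) (e n x)%:E)%E \is a fin_num by near: n.
  rewrite ge0_fin_numE//; apply: integral_ge0 => x _.
  by rewrite lee_fin normr_ge0.
have mh g : step_limit mu D g -> measurable_fun D (fun x => P h (g x)).
  by move=> lg; apply: measurable_comp_step_limit lg _ => //; exact: ip_continuous.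
have he n x : `|P h (f x) - P h (step_eval (s n) x)| <= `|h| * e n x.
  by rewrite -ipBr norm_ip_le.
have ih n : mu.-integrable D (EFin \o e n) -> mu.-integrable D
    (EFin \o (fun x => P h (f x) - P h (step_eval (s n) x))).
  move=> ien; apply: (@le_integrable_real _ _ _ _ _ _ (fun x => `|h| * e n x)) => //.
    by apply: measurable_funB; apply: mh => //; exact: step_limit_step.
  exact: integrable_realZ.
have ist n := (step_weak_integral P (s n) mD h).1.
have ifh : mu.-integrable D (EFin \o (fun x => P h (f x))).
  have [N _ HN] := ie; have := ih N (HN N (leqnn _)).
  move=> /(integrable_realD mD (ist N)); apply: eq_integrable => // x _ /=.
  by congr EFin; rewrite addrC subrK.
split => //.
have c1 : P h (step_integral D (s n)) @[n --> \oo] --> P h y.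
  by apply: continuous_cvg => //; exact: ip_continuous.
apply: cvg_unique c1 => //.
apply/cvgrPdist_le => eps eps0.
have eps'0 : 0 < eps / (`|h| + 1) by rewrite divr_gt0// ltr_wpDl.
move/cvgrPdist_le : cvg_e => /(_ _ eps'0) ce.
near=> n.
have ien : mu.-integrable D (EFin \o e n) by near: n.
rewrite -(step_weak_integral P (s n) mD h).2 -RintegralB//.
apply: le_trans (le_normr_Rintegral mD (ih n ien)) _.
apply: (@le_trans _ _ (\int[mu]_(x in D) (`|h| * e n x))).
  apply: le_Rintegral => //.
  - exact/integrable_norm/ih.
  - exact: integrable_realZ.
rewrite RintegralZl//.
have : \int[mu]_(x in D) e n x <= eps / (`|h| + 1).
  have : `|0 - \int[mu]_(x in D) e n x| <= eps / (`|h| + 1) by near: n.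
  by rewrite sub0r normrN; apply: le_trans; exact: ler_norm.
rewrite ler_pdivlMr ?ltr_wpDl// => /(le_trans _); apply.
rewrite mulrC ler_wpM2l ?lerDl//; apply: Rintegral_ge0 => x _; exact: normr_ge0.
Unshelve. all: by end_near. Qed.

End bochner_off_null.

Section bochner_existence.
Context d (T : measurableType d) (R : realType).
Variable mu : {measure set T -> \bar R}.

(** Step maps are replaced by 0 where their norm exceeds [2 * `|f x|].  The
    limit is the same: the norm is eventually below this bound where [f x] is
    nonzero, and the truncated maps vanish where [f x] does. *)
Lemma step_limit_truncate (E : normedModType R) D (f : T -> E) :
  measurable D -> step_limit mu D f ->
  exists s : nat -> step_map mu E,
    (forall x, D x -> step_eval (s n) x @[n --> \oo] --> f x) /\
    (forall n x, D x -> `|step_eval (s n) x| <= 2 * `|f x|).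
Proof.
move=> mD lf; have [s sf] := lf.
pose B n := D `&` [set x | `|step_eval (s n) x| <= 2 * `|f x|].
have mB n : measurable (B n).
  have mle : measurable_fun D
      (fun x => `|step_eval (s n) x| <= 2 * `|f x|).
    apply: measurable_fun_ler.
      by apply: measurable_funTS; exact: (measurable_comp_step Num.norm).
    by apply: measurable_funM => //; exact: step_limit_norm lf.
  exact: (mle mD [set true]).
exists (fun n => sval (step_restrict (s n) (mB n))); split => [x Dx|n x Dx].
  have [fx0|fx0] := eqVneq (f x) 0.
    rewrite fx0; under eq_cvg do rewrite (svalP (step_restrict _ _)).
    apply: cvg_near_cst; apply: nearW => n.
    rewrite indicE; have [/set_mem[_]|] := boolP (x \in B n) => /=.
      by rewrite fx0 normr0 mulr0 normr_le0 => /eqP ->; rewrite scaler0.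
    by rewrite scale0r.
  apply: cvg_trans (sf x Dx); apply: near_eq_cvg; near=> n.
  rewrite (svalP (step_restrict _ _)) indicE mem_set ?scale1r//; split => //=.
  have sfx : `|f x - step_eval (s n) x| <= `|f x|.
    by near: n; apply: cvgr_dist_le (sf x Dx) _ _; rewrite normr_gt0.
  rewrite -[step_eval _ _](subrK (f x)) (le_trans (ler_normD _ _))//.
  by rewrite distrC mulr2n mulrDl mul1r lerD.
rewrite (svalP (step_restrict _ _)) indicE.
have [/set_mem[_]|_] := boolP (x \in B n); first by rewrite scale1r.
by rewrite scale0r normr0 mulr_ge0.
Unshelve. all: by end_near. Qed.

(** After truncation the p.+1-th power of the error is dominated by
    [3 ^+ p.+1 * `|f x| ^+ p.+1].  The exponents of interest are 1, for the
    Bochner integral, and 2, for controls. *)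
Lemma step_limit_truncate_cvg (E : normedModType R) D (f : T -> E) (p : nat) :
  measurable D -> step_limit mu D f ->
  mu.-integrable D (EFin \o (fun x => `|f x| ^+ p.+1)) ->
  exists s : nat -> step_map mu E,
    (forall x, D x -> step_eval (s n) x @[n --> \oo] --> f x) /\
    (forall n, mu.-integrable D
        (EFin \o (fun x => `|f x - step_eval (s n) x| ^+ p.+1))) /\
    \int[mu]_(x in D) (`|f x - step_eval (s n) x| ^+ p.+1) @[n --> \oo] --> 0.
Proof.
move=> mD lf fi; have [s [sf sle]] := step_limit_truncate mD lf.
exists s; split => //.
have m n : measurable_fun D (fun x => `|f x - step_eval (s n) x| ^+ p.+1).
  apply: measurable_funX; apply: (step_limit_norm (mu := mu)) => //.
  by apply: step_limitB => //; exact: step_limit_step.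
have b n x : D x -> `| `|f x - step_eval (s n) x| ^+ p.+1| <=
    3 ^+ p.+1 * `|f x| ^+ p.+1.
  move=> Dx; rewrite normrX normr_id -exprMn ler_pXn2r ?nnegrE ?mulr_ge0//.
  rewrite (le_trans (ler_normB _ _))// (le_trans (lerD (lexx _) (sle n x Dx)))//.
  lra.
have gi : mu.-integrable D (EFin \o (fun x => 3 ^+ p.+1 * `|f x| ^+ p.+1)).
  exact: integrable_realZ.
split; first by move=> n; apply: le_integrable_real gi => //; exact: b.
have [|_] := @Rdominated_convergence _ _ _ mu D
  (fun n x => `|f x - step_eval (s n) x| ^+ p.+1) (cst 0) _ mD m _ gi b.
  move=> x Dx; rewrite (_ : cst 0 x = 0 ^+ p.+1); last by rewrite /cst expr0n.
  apply: (@continuous_cvg _ _ _ _ _ _ (fun y : R => y ^+ p.+1)).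
    exact: exprn_continuous.
  rewrite -(normr0 E) -[X in `|X|](subrr (f x)); apply: cvg_norm.
  by apply: cvgB; [exact: cvg_cst|exact: sf].
by rewrite Rintegral_cst// mul0r.
Qed.

(** The integrals of two truncated step maps differ at most by the L1 distance
    of the maps, so they form a Cauchy sequence. *)
Lemma bochner_integral_ex (E : completeNormedModType R)
    (P : real_inner_product E) D (f : T -> E) :
  measurable D -> bochner_class mu D f -> exists y, is_bochner_integral mu D f y.
Proof.
move=> mD [lf fi]; have [s [sf [si s0]]] := @step_limit_truncate_cvg _ D f 0 mD lf fi.
pose e n x := `|f x - step_eval (s n) x|.
have ei n : mu.-integrable D (EFin \o e n) := si n.
have e0 : \int[mu]_(x in D) e n x @[n --> \oo] --> 0 := s0.
have ce : cauchy ((fun n => step_integral D (s n)) @ \oo).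
  apply: cauchy_exP => eps eps0.
  have eps20 : 0 < eps / 3 by rewrite divr_gt0.
  move/cvgrPdist_le : e0 => /(_ _ eps20)[N _ HN].
  have le n : (N <= n)%N -> \int[mu]_(x in D) e n x <= eps / 3.
    move=> Nn; have := HN n Nn; rewrite /= sub0r normrN; apply: le_trans.
    exact: ler_norm.
  exists (step_integral D (s N)); exists N => // n Nn.
  rewrite /= -ball_normE /ball_/=.
  have := weak_integral_norm mD (weak_integralB mD
    (step_weak_integral P (s N) mD) (step_weak_integral P (s n) mD))
    (integrable_realD mD (ei N) (ei n)).
  rewrite RintegralD// => h; apply: le_lt_trans (h _) _.
    move=> x _; rewrite /e -(distrC _ (f x)).
    by rewrite (le_trans _ (ler_normD _ _))// addrA subrK.
  apply: le_lt_trans (lerD (le N (leqnn _)) (le n Nn)) _; lra.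
have /cauchy_cvgP/cvg_ex[y sy] := ce.
exists y, s; split => //; first by apply: aeW => x Dx; exact: sf.
apply/fine_cvgP; split => //.
by apply: nearW => n; exact: (integrable_fin_num mD (ei n)).
Qed.

Lemma bochnerP (E : completeNormedModType R) (P : real_inner_product E) D
    (f : T -> E) : measurable D -> bochner_class mu D f ->
  is_bochner_integral mu D f (bochner_integral mu D f) /\
  weak_integral mu P D f (bochner_integral mu D f).
Proof.
move=> mD cf; have [y fy] := bochner_integral_ex P mD cf.
have h : is_bochner_integral mu D f (bochner_integral mu D f).
  by have := @xgetPex _ 0 [set y | is_bochner_integral mu D f y]; apply; exists y.
by split => //; apply: bochner_weak_integral h => //; case: cf.
Qed.

Lemma weak_bochnerE (E : completeNormedModType R) (P : real_inner_product E) D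
    (f : T -> E) y : measurable D -> bochner_class mu D f ->
  weak_integral mu P D f y -> bochner_integral mu D f = y.
Proof.
by move=> mD cf; apply: weak_integral_unique; exact: (bochnerP P mD cf).2.
Qed.

Lemma bochner_class_linear (E F : normedModType R) (L : {linear E -> F})
    (M : R) D (f : T -> E) : measurable D ->
  (forall x, `|L x| <= M * `|x|) -> continuous L ->
  bochner_class mu D f -> bochner_class mu D (L \o f).
Proof.
move=> mD LM cL [lf fi].
have lLf : step_limit mu D (L \o f) by exact: step_limit_linear.
split => //; apply: (@le_integrable_real _ _ _ _ _ _ (fun x => M * `|f x|)) => //.
- exact: step_limit_norm lLf.
- by move=> x _; rewrite normr_id; exact: LM.
- exact: integrable_realZ.
Qed.

(** The images under [L] of the approximating step maps approximate [L \o f].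
    On weak integrals, the same statement would involve the adjoint of [L]. *)
Lemma bochner_integral_linear (E F : completeNormedModType R)
    (P : real_inner_product E) (Q : real_inner_product F)
    (L : {linear E -> F}) (M : R) D (f : T -> E) : measurable D ->
  (forall x, `|L x| <= M * `|x|) -> continuous L -> bochner_class mu D f ->
  bochner_integral mu D (L \o f) = L (bochner_integral mu D f).
Proof.
move=> mD LM cL cf; have [lf _] := cf.
have cLf := bochner_class_linear mD LM cL cf.
apply: (weak_bochnerE (P := Q)) => //.
apply: bochner_weak_integral => //; first by case: cLf.
have [[s [s1 s2 s3]] _] := bochnerP P mD cf.
pose L' n := sval (step_map_linear L (s n)).
have [L'1 L'2] : (forall n x, step_eval (L' n) x = L (step_eval (s n) x)) /\
   (forall n, step_integral D (L' n) = L (step_integral D (s n))).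
  by split=> n; have [h1 h2] := svalP (step_map_linear L (s n)).
exists L'; split.
- case: s1 => N [mN N0 sN]; exists N; split => // x /=.
  apply: contra_notP => Nx Dx; under eq_cvg do rewrite L'1.
  apply: continuous_cvg; first exact: cL.
  by move: Dx; apply: contrapT => h; apply: Nx; exact: sN.
- have M0 (x : E) : 0 <= M * `|x| by exact: le_trans (normr_ge0 (L x)) (LM x).
  pose e n x := `|f x - step_eval (s n) x|.
  have me n : measurable_fun D (e n).
    apply: (step_limit_norm (mu := mu)) => //.
    by apply: step_limitB => //; exact: step_limit_step.
  apply: (@squeeze_cvge _ _ _ _ (cst 0%E) _
      (fun n => (`|M|%:E * \int[mu]_(x in D) (e n x)%:E)%E)).
  + apply: nearW => n; apply/andP; split.
      by apply: integral_ge0 => x _; rewrite lee_fin.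
    rewrite -ge0_integralZl//; last 2 first.
    * exact/measurable_EFinP.
    * by move=> x _; rewrite lee_fin /e.
    apply: ge0_le_integral => //.
    * apply/measurable_EFinP; apply: (step_limit_norm (mu := mu)) => //.
      by apply: step_limitB; [case: cLf|exact: step_limit_step].
    * by apply/measurable_EFinP; exact: measurable_funM.
    * move=> x _; rewrite L'1 -linearB lee_fin (le_trans (LM _))//.
      by rewrite ler_wpM2r ?ler_norm.
  + exact: cvg_cst.
  + by rewrite -(mule0 `|M|%:E); apply: cvgeZl.
- under eq_cvg do rewrite L'2.
  by apply: continuous_cvg; [exact: cL|exact: s3].
Qed.

End bochner_existence.

(** * Functions with nonpositive right derivatives *)
Section dini.
Variable R : realType.

(** For a slope [e > 0], consider the times up to which [g] stays below the line
    of slope [e] starting from [g a].  By continuity their supremum is one of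
    them, and by the bound on the right of it, it cannot be less than [b]. *)
Lemma dini_nonincreasing (g : R -> R) (a b : R) : a <= b ->
  {within `[a, b], continuous g} ->
  (forall t e, a <= t -> t < b -> 0 < e -> exists2 d : R, 0 < d &
     forall h, 0 < h -> h < d -> t + h <= b -> g (t + h) - g t <= e * h) ->
  g b <= g a.
Proof.
move=> ab /subspace_continuousP cg dini; apply/ler_addgt0Pr => eta eta0.
pose e := eta / (b - a + 1).
have ba0 : 0 < b - a + 1 by rewrite ltr_wpDl ?subr_ge0.
have e0 : 0 < e by rewrite divr_gt0.
suff h : g b <= g a + e * (b - a).
  rewrite (le_trans h)// lerD2l /e mulrAC ler_pdivrMr// ler_pM2l// lerDl//.
pose A := [set t | a <= t <= b /\
  forall s, a <= s -> s <= t -> g s <= g a + e * (s - a)].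
have Aa : A a.
  split; first by rewrite lexx.
  by move=> s h1 h2; rewrite (@le_anti _ _ s a) ?h1 ?h2// subrr mulr0 addr0.
have hA : has_sup A by split; [exists a|exists b => t [/andP[]]].
pose c := sup A.
have ac : a <= c by exact: (sup_upper_bound hA).
have cb : c <= b by apply: ge_sup; [exists a|move=> t [/andP[]]].
have ltc s : a <= s -> s < c -> g s <= g a + e * (s - a).
  move=> h1 h2; have [t [_ At] st] := sup_gt (ex_intro _ _ Aa) h2.
  by apply: At => //; exact: ltW.
have gc : g c <= g a + e * (c - a).
  have [->|ca] := eqVneq c a; first by rewrite subrr mulr0 addr0.
  have {}ca : a < c by rewrite lt_neqAle eq_sym ca.
  apply/ler_addgt0Pr => z z0.
  have /cg : `[a, b]%classic c by rewrite /= in_itv/= ac cb.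
  move=> /cvgrPdist_le /(_ _ z0) /nbhs_ballP[d /= d0 Hd].
  pose s := Num.max a (c - d / 2).
  have sc : s < c by rewrite gt_max ca ltrBlDr ltrDl divr_gt0.
  have as_ : a <= s by rewrite le_max lexx.
  have : `|g c - g s| <= z.
    apply: Hd; last by rewrite /= in_itv/= as_ (le_trans (ltW sc)).
    rewrite /ball/= ger0_norm ?subr_ge0 ?(ltW sc)//.
    have : c - d / 2 <= s by rewrite le_max lexx orbT.
    by lra.
  move=> /ler_normlW; have := ltc s as_ sc.
  have : e * (s - a) <= e * (c - a) by rewrite ler_pM2l// lerD2r ltW.
  by lra.
have [cbE|ncb] := eqVneq c b; first by rewrite -cbE.
have {}cb : c < b by rewrite lt_neqAle ncb cb.
have [d d0 Hd] := dini c e ac cb e0.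
pose h := Num.min (d / 2) (b - c).
have h0 : 0 < h by rewrite lt_min divr_gt0//= subr_gt0.
have hd : h < d by rewrite gt_min; apply/orP; left; lra.
have hb : c + h <= b.
  have : h <= b - c by rewrite ge_min lexx orbT.
  by lra.
have : A (c + h).
  split; first by rewrite hb andbT (le_trans ac)// lerDl ltW.
  move=> s as_ sch; have [sc|cs] := ltP s c; first exact: ltc.
  have [->//|nsc] := eqVneq s c.
  have {}cs : c < s by rewrite lt_neqAle eq_sym nsc cs.
  have := Hd (s - c); rewrite subr_gt0 cs => /(_ isT).
  rewrite addrCA subrr addr0 => h1; have h2 : s - c < d by lra.
  have h3 : s <= b by lra.
  have := h1 h2 h3; rewrite !mulrBr in gc *; lra.
by move=> /(sup_upper_bound hA); rewrite -/c; lra.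
Qed.

(** Reduces limits in time to sequences, for which dominated convergence
    holds. *)
Lemma cvg_from_seq (E : normedModType R) (f : R -> E) (p : R) (l : E) :
  (forall u : nat -> R, u n @[n --> \oo] --> p -> f (u n) @[n --> \oo] --> l) ->
  f x @[x --> p] --> l.
Proof.
move=> H; apply/(subr_cvg0 f l); apply: norm_cvg0.
apply: (@cvg_nbhsP R R^o (fun x => `|f x - l|) p 0).2 => u up.
by have /(subr_cvg0 (f \o u) l)/cvg_norm := H u up; rewrite normr0.
Qed.

End dini.
(** * Uniform grids *)
Section grid.
Variable R : realType.
(** On [0, +oo[, the functions [w \o grid N] are those which are constant on the
    cells of the grid of mesh [N.+1%:R^-1]; the cells are closed on the left, so that such a
    function is constant on a right neighbourhood of each time. *)
Definition grid (N : nat) (s : R) : R :=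
  (Num.truncn (s * N.+1%:R))%:R / N.+1%:R.

Lemma grid_le N s : 0 <= s -> grid N s <= s.
Proof.
by move=> s0; rewrite ler_pdivrMr ?ltr0n// truncn_le mulr_ge0.
Qed.

Lemma grid_ge0 N s : 0 <= grid N s.
Proof. by rewrite divr_ge0. Qed.

Lemma grid_gt N s : s < grid N s + N.+1%:R^-1.
Proof.
have -> : grid N s + N.+1%:R^-1 = (Num.truncn (s * N.+1%:R)).+1%:R / N.+1%:R.
  by rewrite -[in RHS]natr1 mulrDl mul1r.
by rewrite ltr_pdivlMr ?ltr0n// truncnS_gt.
Qed.

Lemma grid_cvg s : 0 <= s -> grid N s @[N --> \oo] --> s.
Proof.
move=> s0; apply: (@squeeze_cvgr _ _ _ _ (fun N => s - N.+1%:R^-1) (cst s)).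
- by apply: nearW => N; rewrite grid_le// andbT lerBlDr ltW// grid_gt.
- rewrite -[X in _ --> X]subr0; apply: cvgB; first exact: cvg_cst.
  exact: cvg_harmonic.
- exact: cvg_cst.
Qed.

Lemma grid_right N s : 0 <= s -> exists2 d : R, 0 < d &
  forall h, 0 <= h -> h < d -> grid N (s + h) = grid N s.
Proof.
move=> s0; exists (grid N s + N.+1%:R^-1 - s).
  by rewrite subr_gt0 grid_gt.
move=> h h0 hd; congr (_ %:R / _); apply: truncn_def.
have N0 : 0 < N.+1%:R :> R by [].
have h1 : grid N s <= s + h by rewrite (le_trans (grid_le N s0))// lerDl.
have h2 : s + h < grid N s + N.+1%:R^-1 by move: hd; rewrite ltrBrDl.
by rewrite -ler_pdivrMr// h1/= -ltr_pdivlMr// -natr1 mulrDl mul1r.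
Qed.

Notation mu := (@lebesgue_measure R).

Lemma step_sum (E : normedModType R) (m : nat) (A : nat -> set R)
    (t : nat -> step_map mu E) : (forall j, measurable (A j)) ->
  exists s : step_map mu E, forall x,
    step_eval s x = \sum_(j < m) (\1_(A j) x : R) *: step_eval (t j) x.
Proof.
move=> mA; elim: m => [|m [s sE]].
  exists (sval (step_restrict (t 0%N) measurable0)) => x.
  by rewrite (svalP (step_restrict _ _)) indic0 scale0r big_ord0.
exists (sval (step_add s (sval (step_restrict (t m) (mA m))))) => x.
by rewrite (svalP (step_add _ _)) (svalP (step_restrict _ _)) sE big_ord_recr.
Qed.

(** Only finitely many cells meet [0, b], so that a step map can be chosen for
    each of them. *)
Lemma grid_step_choice (E : normedModType R) (t : nat -> step_map mu E) N b :
  exists s : step_map mu E, forall x, 0 <= x -> x <= b ->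
    step_eval s x = step_eval (t (Num.truncn (x * N.+1%:R))) x.
Proof.
have N0 : 0 < N.+1%:R :> R by [].
pose A (j : nat) : set R := `[j%:R / N.+1%:R, j.+1%:R / N.+1%:R[%classic.
have AE j x : 0 <= x -> (x \in A j) = (Num.truncn (x * N.+1%:R) == j).
  move=> x0; rewrite truncn_eq ?mulr_ge0//.
  rewrite -ler_pdivrMr// -ltr_pdivlMr//.
  by apply/idP/idP => [/set_mem|h]; [|apply/mem_set]; rewrite /A /= in_itv.
have [|s sE] := @step_sum E (Num.truncn (b * N.+1%:R)).+1 A t.
  by move=> j; exact: measurable_itv.
exists s => x x0 xb; rewrite sE.
have kb : (Num.truncn (x * N.+1%:R)%R < (Num.truncn (b * N.+1%:R)%R).+1)%N.
  by rewrite ltnS le_truncn// ler_pM2r.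
rewrite (bigD1 (Ordinal kb))//= [X in _ + X]big1 ?addr0.
  by rewrite indicE AE// eqxx scale1r.
move=> j jk; suff -> : \1_(A j) x = 0 :> R by rewrite scale0r.
rewrite indicE AE//; case: eqP => // tj.
by move/eqP: jk; case; exact/val_inj.
Qed.

Lemma grid_step_linear (E F : normedModType R) (L : R -> {linear E -> F})
    (s : step_map mu E) N b : exists s' : step_map mu F,
  forall x, 0 <= x -> x <= b -> step_eval s' x = L (grid N x) (step_eval s x).
Proof.
have [s' s'E] := grid_step_choice
  (fun j => sval (step_map_linear (L (j%:R / N.+1%:R)) s)) N b.
by exists s' => x x0 xb; rewrite s'E// (svalP (step_map_linear _ _)).1.
Qed.

Lemma grid_step (E : normedModType R) (W : R -> E) N b :
  exists s : step_map mu E,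
  forall x, 0 <= x -> x <= b -> step_eval s x = W (grid N x).
Proof.
have mb : measurable (`[0, b]%classic : set R) by exact: measurable_itv.
have fb : (mu `[0%R, b]%classic < +oo)%E.
  by rewrite lebesgue_measure_itv/=; case: ifPn => // _; rewrite ltry.
have [s sE] := grid_step_choice (fun j => @step_of _ _ _ mu E 'I_1
  (fun=> `[0, b]%classic) (fun=> W (j%:R / N.+1%:R)) (fun=> mb) (fun=> fb)) N b.
exists s => x x0 xb; rewrite sE// step_ofE big_ord1 indicE mem_set//=.
  by rewrite scale1r.
by rewrite /= in_itv/= x0.
Qed.

Lemma step_limit_grid (E : normedModType R) (W : R -> E) N b :
  step_limit mu `[0, b]%classic (fun x => W (grid N x)).
Proof.
have [s sE] := grid_step W N b.
apply: step_limit_eq (step_limit_step _ s) => x.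
by rewrite /= in_itv/= => /andP[x0 xb]; exact: sE.
Qed.

End grid.

(** * Density of the grid functions in L2 *)
Section grid_density.
Variable R : realType.
Notation mu := (@lebesgue_measure R).

Lemma finite_segment (a b : R) : (mu `[a, b]%classic < +oo)%E.
Proof.
by rewrite lebesgue_measure_itv/=; case: ifPn => // _; rewrite -EFinB ltry.
Qed.

Lemma measurable_segment (a b : R) : measurable (`[a, b]%classic : set R).
Proof. exact: measurable_itv. Qed.
#[local] Hint Resolve measurable_segment finite_segment : core.

Lemma Rintegral_cst_itv (a b r : R) : a <= b ->
  \int[mu]_(s in `[a, b]%classic) r = (b - a) * r.
Proof.
move=> ab; rewrite Rintegral_cst; last exact: measurable_segment.
rewrite mulrC; congr (_ * _).
have e : mu `[a, b]%classic = (b - a)%:E.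
  rewrite (@lebesgue_measure_itv R `[a, b])/= lte_fin.
  by case: ltgtP ab => // -> _; rewrite subrr.
exact: (congr1 fine e).
Qed.

Lemma continuous_itv_integrable (f : R -> R) (a b : R) : continuous f ->
  mu.-integrable `[a, b]%classic (EFin \o f).
Proof.
move=> cf; apply: continuous_compact_integrable; first exact: segment_compact.
exact: continuous_subspaceT.
Qed.

Lemma norm_sq_triangle (E : normedModType R) (x y z : E) :
  `|x - z| ^+ 2 <= 2 * `|x - y| ^+ 2 + 2 * `|y - z| ^+ 2.
Proof.
have h : `|x - z| <= `|x - y| + `|y - z|.
  by rewrite (le_trans _ (ler_normD _ _))// addrA subrK.
have : `|x - z| ^+ 2 <= (`|x - y| + `|y - z|) ^+ 2.
  by rewrite ler_pXn2r ?nnegrE// addr_ge0.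
move/le_trans; apply; have := sqr_ge0 (`|x - y| - `|y - z|).
by rewrite sqrrB sqrrD; lra.
Qed.

Variable (U : normedModType R) (b : R).
Notation D := (`[0, b]%classic : set R).

(** All fine enough grids have to give an approximation: this is what makes the
    notion additive, two functions being approximated on a common grid. *)
Definition grid_approximable (u : R -> U) := forall e : R, 0 < e ->
  exists N0 : nat, forall N, (N0 <= N)%N -> exists w : R -> U,
    mu.-integrable D (EFin \o (fun s => `|u s - w (grid N s)| ^+ 2)) /\
    \int[mu]_(s in D) (`|u s - w (grid N s)| ^+ 2) <= e.

Lemma measurable_norm_sqB (f g : R -> U) :
  step_limit mu D f -> step_limit mu D g ->
  measurable_fun D (fun s => `|f s - g s| ^+ 2).
Proof.
move=> lf lg; apply: measurable_funX; apply: (step_limit_norm (mu := mu)) => //.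
exact: step_limitB.
Qed.

Lemma grid_approximable_close (u : R -> U) : step_limit mu D u ->
  (forall e : R, 0 < e -> exists u' : R -> U,
    [/\ step_limit mu D u', grid_approximable u',
      mu.-integrable D (EFin \o (fun s => `|u s - u' s| ^+ 2)) &
      \int[mu]_(s in D) (`|u s - u' s| ^+ 2) <= e]) ->
  grid_approximable u.
Proof.
move=> lu H e e0; have e40 : 0 < e / 4 by rewrite divr_gt0.
have [u' [lu' gu' iu' uu']] := H _ e40.
have [N0 HN0] := gu' _ e40; exists N0 => N /HN0[w [iw we]]; exists w.
have gi : mu.-integrable D (EFin \o (fun s =>
    2 * `|u s - u' s| ^+ 2 + 2 * `|u' s - w (grid N s)| ^+ 2)).
  by apply: integrable_realD => //; exact: integrable_realZ.
have le s : `|u s - w (grid N s)| ^+ 2 <=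
    2 * `|u s - u' s| ^+ 2 + 2 * `|u' s - w (grid N s)| ^+ 2.
  exact: norm_sq_triangle.
have i2 : mu.-integrable D (EFin \o (fun s => `|u s - w (grid N s)| ^+ 2)).
  apply: le_integrable_real gi => //.
    by apply: measurable_norm_sqB => //; exact: step_limit_grid.
  by move=> s _; rewrite ger0_norm ?sqr_ge0.
split => //; apply: le_trans (le_Rintegral _ i2 gi (fun s _ => le s)) _ => //.
rewrite RintegralD//; [|exact: integrable_realZ..].
by rewrite !RintegralZl//; lra.
Qed.

Lemma grid_approximableD (u v : R -> U) :
  step_limit mu D u -> step_limit mu D v ->
  grid_approximable u -> grid_approximable v ->
  grid_approximable (fun s => u s + v s).
Proof.
move=> lu lv gu gv e e0; have e40 : 0 < e / 4 by rewrite divr_gt0.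
have [N1 HN1] := gu _ e40; have [N2 HN2] := gv _ e40.
exists (maxn N1 N2) => N; rewrite geq_max => /andP[/HN1[w1 [i1 le1]]].
move=> /HN2[w2 [i2 le2]]; exists (fun s => w1 s + w2 s).
have gi : mu.-integrable D (EFin \o (fun s =>
    2 * `|u s - w1 (grid N s)| ^+ 2 + 2 * `|v s - w2 (grid N s)| ^+ 2)).
  by apply: integrable_realD => //; exact: integrable_realZ.
have le s : `|(u s + v s) - (w1 (grid N s) + w2 (grid N s))| ^+ 2 <=
    2 * `|u s - w1 (grid N s)| ^+ 2 + 2 * `|v s - w2 (grid N s)| ^+ 2.
  have := norm_sq_triangle (u s - w1 (grid N s)) 0 (w2 (grid N s) - v s).
  rewrite subr0 sub0r opprB.
  by rewrite addrACA -opprD.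
have ii : mu.-integrable D (EFin \o (fun s =>
    `|(u s + v s) - (w1 (grid N s) + w2 (grid N s))| ^+ 2)).
  apply: le_integrable_real gi => //.
    apply: measurable_norm_sqB => //; first exact: step_limitD.
    exact: (step_limit_grid (fun s => w1 s + w2 s)).
  by move=> s _; rewrite ger0_norm ?sqr_ge0.
split => //; apply: le_trans (le_Rintegral _ ii gi (fun s _ => le s)) _ => //.
rewrite RintegralD//; [|exact: integrable_realZ..].
by rewrite !RintegralZl//; lra.
Qed.

(** Continuous functions are dense in L1, and clamping to the interval [0, 1]
    brings a function closer to an indicator. *)
Lemma indic_continuous_approx (A : set R) (e : R) : measurable A -> 0 < e ->
  exists g : R -> R, [/\ continuous g, (forall s, 0 <= g s <= 1) &
    \int[mu]_(s in D) `|\1_A s - g s| <= e].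
Proof.
move=> mA e0.
have iA : mu.-integrable D (EFin \o (\1_A : R -> R)).
  apply: (@bounded_integrable _ _ _ _ _ _ 1) => //; first exact: finite_segment.
  by move=> x _; rewrite indicE; case: (x \in A); rewrite ?normr1 ?normr0.
have [g_ [cg ig]] := approximation_continuous_integrable (measurable_segment 0 b)
  (finite_segment 0 b) iA.
move=> /fine_cvgP[_ /cvgrPdist_le/(_ _ e0)[N _ /(_ N (leqnn _))]].
rewrite /= sub0r normrN => /(le_trans (ler_norm _)) gN.
pose g s := Num.min (Num.max (g_ N s) 0) 1.
have cgg : continuous g.
  move=> s; apply: (@continuous_min _ _ (fun s => Num.max (g_ N s) 0) (cst 1)).
    by apply: (@continuous_max _ _ (g_ N) (cst 0)); [exact: cg|exact: cvg_cst].
  exact: cvg_cst.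
exists g; split => //.
  by move=> s; rewrite /g le_min le_max lexx orbT ler01 ge_min lexx orbT.
apply: le_trans gN; apply: le_Rintegral => //.
- apply: integrable_norm; apply: integrable_realB => //.
  exact: continuous_itv_integrable.
- apply: integrable_norm; apply: integrable_realB => //; exact: ig.
- move=> s _; rewrite indicE /g.
  have := ler_norm ((s \in A)%:R - g_ N s).
  have := ler_norm (- ((s \in A)%:R - g_ N s)); rewrite normrN.
  set y := `|_ - g_ N s|.
  have [h|h] := leP (g_ N s) 0; have [h'|h'] := leP _ 1;
    by rewrite ler_norml; case: (s \in A) => /=; lra.
Qed.

(** Between functions with values in [0, 1], the L1 distance bounds the square of
    the L2 distance.  The indicator is approximated in L1 by a continuous
    function, and the latter by its samples on the grid. *)
Lemma grid_approximable_indic (A : set R) (v : U) : measurable A ->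
  grid_approximable (fun s => (\1_A s : R) *: v).
Proof.
move=> mA e e0.
(* Each of the two L1 errors is at most [e'], and is multiplied by [`|v| ^+ 2]. *)
pose e' := e / (2 * (`|v| ^+ 2 + 1)).
have v0 : 0 < `|v| ^+ 2 + 1 by rewrite ltr_wpDl// sqr_ge0.
have e'0 : 0 < e' by rewrite divr_gt0// mulr_gt0.
have [g [cg g01 ge]] := indic_continuous_approx mA e'0.
have mgrid N : measurable_fun D (fun s => g (grid N s)).
  apply: (measurable_comp_step_limit (phi := id) (mu := mu)) => //.
  - exact: (@step_limit_grid _ _ g).
  - by move=> x; exact: cvg_id.
have ig (h : R -> R) : measurable_fun D h -> (forall s, 0 <= h s <= 1) ->
    mu.-integrable D (EFin \o h).
  move=> mh h01; apply: (@bounded_integrable _ _ _ _ _ _ 1) => //; first exact: finite_segment.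
  move=> s _.
  by have /andP[h0 h1] := h01 s; rewrite ger0_norm.
have cgD : measurable_fun D g.
  by apply: measurable_funTS; exact: continuous_measurable_fun.
have H1 N : measurable_fun D (fun s => `|g s - g (grid N s)|).
  by apply: measurableT_comp => //; exact: measurable_funB.
have H2 s : D s -> `|g s - g (grid N s)| @[N --> \oo] --> (0 : R).
  rewrite /= in_itv/= => /andP[s0 _].
  rewrite -(normr0 R) -[X in `|X|](subrr (g s)).
  apply: cvg_norm; apply: cvgB; first exact: cvg_cst.
  by apply: continuous_cvg; [exact: cg|exact: grid_cvg].
have H3 : mu.-integrable D (EFin \o (fun=> 1 : R)).
  by apply: ig => // s; rewrite lexx ler01.
have H4 N s : D s -> `| `|g s - g (grid N s)| | <= 1.
  move=> _; rewrite normr_id ler_norml.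
  by have /andP[? ?] := g01 s; have /andP[? ?] := g01 (grid N s); lra.
have [_] := @Rdominated_convergence _ _ _ mu D
  (fun N s => `|g s - g (grid N s)|) (cst 0) _ (measurable_segment 0 b) H1 H2 H3 H4.
rewrite Rintegral_cst// mul0r => /cvgrPdist_le/(_ _ e'0)[N0 _ HN0].
exists N0 => N /HN0; rewrite /= sub0r normrN => /(le_trans (ler_norm _)) le2.
exists (fun s => g s *: v).
have iA : mu.-integrable D (EFin \o (\1_A : R -> R)).
  by apply: ig => // s; rewrite indicE; case: (s \in A); rewrite /= ?lexx ?ler01.
have i1 : mu.-integrable D (EFin \o (fun s => `|\1_A s - g s|)).
  by apply: integrable_norm; apply: integrable_realB => //; exact: ig.
have i2 : mu.-integrable D (EFin \o (fun s => `|g s - g (grid N s)|)).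
  by apply: integrable_norm; apply: integrable_realB => //; exact: ig.
have gi : mu.-integrable D (EFin \o (fun s => `|v| ^+ 2 *
    (`|\1_A s - g s| + `|g s - g (grid N s)|))).
  by apply: integrable_realZ => //; exact: integrable_realD.
have le s : `|(\1_A s : R) *: v - g (grid N s) *: v| ^+ 2 <= `|v| ^+ 2 *
    (`|\1_A s - g s| + `|g s - g (grid N s)|).
  rewrite -scalerBl normrZ exprMn mulrC ler_wpM2l ?sqr_ge0//.
  apply: (@le_trans _ _ `|\1_A s - g (grid N s)|).
    rewrite expr2 -[leRHS]mulr1 ler_wpM2l//.
    have /andP[? ?] := g01 (grid N s).
    by rewrite indicE ler_norml; case: (s \in A) => /=; lra.
  by rewrite (le_trans _ (ler_normD _ _))// addrA subrK.
have lA : step_limit mu D (fun s => (\1_A s : R) *: v).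
  apply: step_limit_restrict => //.
  apply: step_limitS (step_limit_grid (fun=> v) 0 b).
  by move=> s [].
have ii : mu.-integrable D (EFin \o (fun s =>
    `|(\1_A s : R) *: v - g (grid N s) *: v| ^+ 2)).
  apply: le_integrable_real gi => //.
    apply: measurable_norm_sqB => //.
    exact: (step_limit_grid (fun s => g s *: v)).
  by move=> s _; rewrite ger0_norm ?sqr_ge0.
split => //; apply: le_trans (le_Rintegral _ ii gi (fun s _ => le s)) _ => //.
rewrite RintegralZl//; last exact: integrable_realD.
rewrite RintegralD//.
have : \int[mu]_(s in D) `|\1_A s - g s| +
    \int[mu]_(s in D) `|g s - g (grid N s)| <= e / (`|v| ^+ 2 + 1).
  have -> : e / (`|v| ^+ 2 + 1) = e' + e'.
    by rewrite /e'; field; rewrite gt_eqF.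
  exact: lerD.
rewrite ler_pdivlMr// mulrDr mulr1 => h; rewrite mulrC; apply: le_trans h.
by rewrite lerDl addr_ge0//; apply: Rintegral_ge0.
Qed.

Lemma grid_approximable_step (s : step_map mu U) :
  grid_approximable (step_eval s).
Proof.
have mS (i : 'I_(step_size s)) := @step_measurable _ _ _ _ _ s i.
have l1 (i : 'I_(step_size s)) : step_limit mu D (fun x => (\1_(step_set i) x : R) *: step_val i).
  apply: step_limit_restrict; first exact: (mS i).
  apply: step_limitS (step_limit_grid (fun=> step_val i) 0 b).
  by move=> x [].
pose F (r : seq 'I_(step_size s)) (x : R) : U :=
  \sum_(i <- r) (\1_(step_set i) x : R) *: step_val i.
suff h r : step_limit mu D (F r) /\ grid_approximable (F r).
  exact: (h (index_enum _)).2.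
elim: r => [|i r [IH1 IH2]].
  have -> : F [::] = fun=> 0 by apply/funext => x; rewrite /F big_nil.
  split; first exact: (step_limit_grid (fun=> 0) 0 b).
  move=> e e0; exists 0%N => N _; exists (fun=> 0).
  under [X in EFin \o X]eq_fun do rewrite subrr normr0 expr0n.
  under eq_Rintegral do rewrite subrr normr0 expr0n.
  by rewrite Rintegral_cst// mul0r; split; [exact: integrable0|exact: ltW].
have -> : F (i :: r) =
    fun x => (\1_(step_set i) x : R) *: step_val i + F r x.
  by apply/funext => x; rewrite /F big_cons.
split; first exact: step_limitD.
by apply: grid_approximableD => //; apply: grid_approximable_indic; exact: mS.
Qed.

Lemma L2_grid_approximable (u : R -> U) : step_limit mu D u ->
  mu.-integrable D (EFin \o (fun s => `|u s| ^+ 2)) -> grid_approximable u.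
Proof.
move=> lu iu; have [s [_ [si s0]]] := @step_limit_truncate_cvg _ _ _ mu _ _ u 1
  (measurable_segment 0 b) lu iu.
apply: grid_approximable_close => // e e0.
move/cvgrPdist_le : s0 => /(_ _ e0)[N _ /(_ N (leqnn _))].
rewrite /= sub0r normrN => /(le_trans (ler_norm _)) sN.
exists (step_eval (s N)); split => //; first exact: step_limit_step.
exact: grid_approximable_step.
Qed.

Lemma L2_grid_sequence (u : R -> U) : step_limit mu D u ->
  mu.-integrable D (EFin \o (fun s => `|u s| ^+ 2)) ->
  exists (N : nat -> nat) (w : nat -> R -> U),
    (forall n, mu.-integrable D
       (EFin \o (fun s => `|u s - w n (grid (N n) s)| ^+ 2))) /\
    \int[mu]_(s in D) (`|u s - w n (grid (N n) s)| ^+ 2) @[n --> \oo] --> 0.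
Proof.
move=> lu iu.
have H n : exists p : nat * (R -> U),
    mu.-integrable D (EFin \o (fun s => `|u s - p.2 (grid p.1 s)| ^+ 2)) /\
    \int[mu]_(s in D) (`|u s - p.2 (grid p.1 s)| ^+ 2) <= n.+1%:R^-1.
  have [|N0 /(_ N0 (leqnn _))[w hw]] := L2_grid_approximable lu iu (e := n.+1%:R^-1).
    by rewrite invr_gt0.
  by exists (N0, w).
have [p pP] := choice H.
exists (fun n => (p n).1), (fun n => (p n).2); split; first by move=> n; case: (pP n).
apply: (@squeeze_cvgr _ _ _ _ (cst 0) (fun n => n.+1%:R^-1)).
- apply: nearW => n; rewrite (pP n).2 andbT; apply: Rintegral_ge0 => s _.
  exact: sqr_ge0.
- exact: cvg_cst.
- exact: cvg_harmonic.
Qed.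

End grid_density.

(** * Semigroups *)
Lemma bounded_linear_continuous (R : realType) (E F : normedModType R)
    (L : {linear E -> F}) (M : R) :
  (forall x, `|L x| <= M * `|x|) -> continuous L.
Proof.
move=> LM x; apply/cvgrPdist_le => e e0.
have M0 : 0 < `|M| + 1 by rewrite ltr_wpDl.
near=> y; rewrite -linearB (le_trans (LM _))//.
have : `|x - y| <= e / (`|M| + 1).
  by near: y; apply: cvgr_dist_le => //; rewrite divr_gt0.
rewrite ler_pdivlMr// => /(le_trans _); apply.
by rewrite mulrC ler_wpM2l// (le_trans (ler_norm M))// lerDl.
Unshelve. all: by end_near. Qed.

Record c0_semigroup (R : realType) (E : normedModType R)
    (S : R -> {linear E -> E}) : Prop := C0Semigroup {
  sg_bounded : forall t, 0 <= t -> exists M, forall x, `|S t x| <= M * `|x| ;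
  sg_zero : forall x, S 0 x = x ;
  sg_add : forall s t, 0 <= s -> 0 <= t -> forall x, S (s + t) x = S s (S t x) ;
  sg_cvg : forall x, S t x @[t --> 0^'+] --> x }.

Section semigroup_theory.
Variables (R : realType) (E : completeNormedModType R).
Variables (S : R -> {linear E -> E}) (hS : c0_semigroup S).

Lemma sg_near0 x e : 0 < e -> exists2 d : R, 0 < d &
  forall t, 0 <= t -> t < d -> `|S t x - x| <= e.
Proof.
move=> e0; have /cvgrPdist_le/(_ _ e0) := @sg_cvg _ _ _ hS x.
rewrite near_withinE => /nbhs_ballP[d /= d0 Hd]; exists d => // t t0 td.
have [->|tn0] := eqVneq t 0; first by rewrite sg_zero// subrr normr0 ltW.
rewrite distrC; apply: Hd; first by rewrite /ball/= sub0r normrN ger0_norm.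
by rewrite lt_neqAle eq_sym tn0.
Qed.

(** Otherwise the norms of the [S t_n] would be unbounded for some [t_n] tending
    to 0; but [S t_n x] converges to [x] for all [x], which contradicts the
    Banach-Steinhaus theorem. *)
Lemma sg_locally_bounded : exists M d : R, 0 < d /\
  forall t x, 0 <= t -> t <= d -> `|S t x| <= M * `|x|.
Proof.
apply: contrapT => H.
have {}H n : exists p : R * E,
    [/\ 0 <= p.1, p.1 <= n.+1%:R^-1 & n%:R * `|p.2| < `|S p.1 p.2|].
  apply: contrapT => h; apply: H; exists n%:R, n.+1%:R^-1; split => // t x t0 td.
  by rewrite leNgt; apply/negP => lt; apply: h; exists (t, x).
have [p pP] := choice H.
pose F : set (E -> E) := range (fun n => S (p n).1 : E -> E).
have : uniform_bounded F.
  apply: Banach_Steinhauss.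
    move=> _ [n _ <-]; split; last exact: linearP.
    move=> r; have [p0 _ _] := pP n; have [M HM] := sg_bounded hS p0.
    exists (`|M| * `|r|) => x xr; rewrite (le_trans (HM x))//.
    rewrite (@le_trans _ _ (`|M| * `|x|))//; first by rewrite ler_wpM2r ?ler_norm.
    by rewrite ler_wpM2l// (le_trans xr)// ler_norm.
  move=> x; have [d d0 Hd] := sg_near0 x ltr01.
  pose N := (Num.truncn d^-1).
  exists (`|x| + 1 + \sum_(i < N) `|S (p i).1 x|) => _ [n _ <-].
  have sum0 : 0 <= \sum_(i < N) `|S (p i).1 x| by apply: sumr_ge0.
  have [nN|Nn] := ltnP n N.
    rewrite (bigD1 (Ordinal nN))//= addrCA lerDl addr_ge0// ?addr_ge0//.
    exact: sumr_ge0.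
  have [p0 pn _] := pP n.
  have pd : (p n).1 < d.
    apply: le_lt_trans pn _; rewrite invf_plt ?posrE//.
    by rewrite (lt_le_trans (truncnS_gt _))// ler_nat.
  have := Hd _ p0 pd; have := ler_normD (S (p n).1 x - x) x; rewrite subrK.
  lra.
move=> /(_ 1)[M HM].
pose n := (Num.truncn M).+1.
have Mn : M < n%:R by exact: truncnS_gt.
have [p0 pn] := pP n; set x := (p n).2.
have [->|x0] := eqVneq x 0; first by rewrite linear0 !normr0 mulr0 ltxx.
have nx : 0 < `|x| by rewrite normr_gt0.
have := HM (S (p n).1) (imageT _ n) (`|x|^-1 *: x).
rewrite normrZ normfV normr_id mulVf ?gt_eqF// lexx => /(_ isT).
rewrite linearZ/= normrZ normfV normr_id ler_pdivrMl// => h1.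
apply/negP; rewrite -leNgt (le_trans h1)// mulrC ler_wpM2r// ltW//.
Qed.

Lemma sg_bounded_upto b : exists M : R, 0 < M /\
  forall t x, 0 <= t -> t <= b -> `|S t x| <= M * `|x|.
Proof.
have [M [d [d0 Hd]]] := sg_locally_bounded.
pose M' := Num.max M 1.
have M'1 : 1 <= M' by rewrite le_max lexx orbT.
have M'0 : 0 <= M' by rewrite (le_trans ler01).
have Hd' t x : 0 <= t -> t <= d -> `|S t x| <= M' * `|x|.
  move=> t0 td; rewrite (le_trans (Hd t x t0 td))// ler_wpM2r//.
  by rewrite le_max lexx.
have H n t x : 0 <= t -> t <= n%:R * d -> `|S t x| <= M' ^+ n.+1 * `|x|.
  elim: n t x => [|n IH] t x t0 tn.
    by apply: Hd' => //; rewrite (le_trans tn)// mul0r ltW.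
  have [td|dt] := leP t d.
    rewrite (le_trans (Hd' t x t0 td))// ler_wpM2r// -[leLHS]expr1.
    by rewrite ler_weXn2l.
  rewrite -[t](subrK d) addrC sg_add// ?subr_ge0 ?(ltW dt) ?(ltW d0)//.
  rewrite (le_trans (Hd' _ _ (ltW d0) (lexx _)))// exprS -mulrA ler_wpM2l//.
  apply: IH; first by rewrite subr_ge0 ltW.
  by rewrite lerBlDr (le_trans tn)// -natr1 mulrDl mul1r.
exists (M' ^+ (Num.truncn (b / d)).+2); split.
  by rewrite exprn_gt0// (lt_le_trans ltr01).
move=> t x t0 tb; apply: H => //; rewrite (le_trans tb)//.
by rewrite -ler_pdivrMr// ltW// truncnS_gt.
Qed.

(** Extending the semigroup by the identity to negative times makes the orbits
    continuous on the whole line, and the operators linear and bounded at every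
    time. *)
Definition Sg (t : R) : {linear E -> E} := S (Num.max 0 t).

Lemma SgE t : 0 <= t -> Sg t = S t.
Proof. by move=> t0; rewrite /Sg max_r. Qed.

Lemma Sg0 x : Sg 0 x = x.
Proof. by rewrite SgE// sg_zero. Qed.

Lemma SgD s t x : 0 <= s -> 0 <= t -> Sg (s + t) x = Sg s (Sg t x).
Proof. by move=> s0 t0; rewrite !SgE ?addr_ge0// sg_add. Qed.

Lemma Sg_bounded b : exists M : R, 0 < M /\
  forall t x, t <= b -> `|Sg t x| <= M * `|x|.
Proof.
have [M [M0 HM]] := sg_bounded_upto (Num.max 0 b); exists M; split => //.
move=> t x tb; apply: HM; first by rewrite le_max lexx.
by rewrite ge_max le_max lexx/= le_max tb orbT.
Qed.

Lemma Sg_linear_continuous t : continuous (Sg t).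
Proof.
by have [M [_ HM]] := Sg_bounded t; apply: (bounded_linear_continuous (M := M)) => x; exact: HM.
Qed.

Lemma Sg_continuous x : continuous (fun t => Sg t x).
Proof.
move=> t0; apply/cvgrPdist_le => e e0.
(* Two times [s <= t] near [t0] are compared through [S t = S s (S (t - s))]. *)
have [M [M0 HM]] := sg_bounded_upto (Num.max 0 t0 + 1).
have eM : 0 < e / M by rewrite divr_gt0.
have [d d0 Hd] := sg_near0 x eM.
have key s t : 0 <= s -> s <= t -> t <= Num.max 0 t0 + 1 -> t - s < d ->
    `|S s x - S t x| <= e.
  move=> s0 st tb tsd; have ts0 : 0 <= t - s by rewrite subr_ge0.
  have -> : S t x = S s (S (t - s) x) by rewrite -(sg_add hS)// addrC subrK.
  rewrite -linearB.
  rewrite (le_trans (HM _ _ s0 (le_trans st tb)))// mulrC -ler_pdivlMr//.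
  by rewrite distrC; apply: Hd.
near=> t.
have td : `|t0 - t| < Num.min d 1.
  by near: t; apply: cvgr_dist_lt => //; rewrite lt_min d0 ltr01.
move: td; rewrite lt_min => /andP[]; rewrite !ltr_norml => /andP[h1 h2] /andP[h3 h4].
rewrite /Sg; have [a|a] := leP t0 t.
  have a' : Num.max 0 t0 <= Num.max 0 t by rewrite ge_max !le_max lexx a orbT.
  apply: key => //; first by rewrite le_max lexx.
    by have [?|?] := leP 0 t0; have [?|?] := leP 0 t; lra.
  by have [?|?] := leP 0 t0; have [?|?] := leP 0 t; lra.
have {}a := ltW a.
have a' : Num.max 0 t <= Num.max 0 t0 by rewrite ge_max !le_max lexx a orbT.
rewrite distrC; apply: key => //; first by rewrite le_max lexx.
  by rewrite lerDl.
by have [?|?] := leP 0 t0; have [?|?] := leP 0 t; lra.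
Unshelve. all: by end_near. Qed.

Notation mu := (@lebesgue_measure R).

(** If the step maps [s n] converge to [v], then [Sg (t - grid n x)] applied to
    [s n x] converges to [Sg (t - x) (v x)], by strong continuity and local
    boundedness; it is a step map of [x] because [grid n] takes finitely many
    values on [0, b]. *)
Lemma Sg_step_limit t a b (v : R -> E) : 0 <= a ->
  step_limit mu `[a, b]%classic v ->
  step_limit mu `[a, b]%classic (fun s => Sg (t - s) (v s)).
Proof.
move=> a0 [s sv].
have H n := grid_step_linear (fun r => Sg (t - r)) (s n) n b.
have [s' s'E] := choice H; exists s' => x xab.
have /andP[ax xb] : a <= x <= b by move: xab; rewrite /= in_itv.
have x0 := le_trans a0 ax.
under eq_cvg do rewrite s'E//.
have [M [M0 HM]] := Sg_bounded t.
have c1 : Sg (t - grid n x) (v x) @[n --> \oo] --> Sg (t - x) (v x).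
  apply: (@continuous_cvg _ _ _ _ _ _ (fun r => Sg r (v x))).
    exact: Sg_continuous.
  by apply: cvgB; [exact: cvg_cst|exact: grid_cvg].
apply: cvg_sub0 c1; apply/cvgr0Pnorm_le => e e0; near=> n.
rewrite /= -[X in `|X|]linearB (le_trans (HM _ _ _))//.
  by rewrite gerBl grid_ge0.
rewrite mulrC -ler_pdivlMr// distrC; near: n.
by apply: cvgr_dist_le (sv x xab) _ _; rewrite divr_gt0.
Unshelve. all: by end_near. Qed.

Lemma Sg_bochner_class t a b (v : R -> E) : 0 <= a ->
  bochner_class mu `[a, b]%classic v ->
  bochner_class mu `[a, b]%classic (fun s => Sg (t - s) (v s)).
Proof.
move=> a0 [lv iv]; have lSv := Sg_step_limit t a0 lv.
have [M [M0 HM]] := Sg_bounded t.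
split => //.
apply: (@le_integrable_real _ _ _ mu _ _ (fun x => M * `|v x|)) => //.
- exact: step_limit_norm lSv.
- move=> x; rewrite /= in_itv/= => /andP[ax _]; rewrite normr_id; apply: HM.
  by rewrite gerBl (le_trans a0).
- exact: integrable_realZ.
Qed.

End semigroup_theory.

(** * Mild solutions *)
Section bochner_interval.
Variables (R : realType) (E : completeNormedModType R).
Variable P : real_inner_product E.
Notation mu := (@lebesgue_measure R).

Lemma bochner_classS (A B : set R) (f : R -> E) : measurable A -> measurable B ->
  A `<=` B -> bochner_class mu B f -> bochner_class mu A f.
Proof.
move=> mA mB AB [lf fi]; split; first exact: step_limitS lf.
exact: integrableS fi.
Qed.

Lemma bochner_class_sub (a b a' b' : R) (f : R -> E) : a <= a' -> b' <= b ->
  bochner_class mu `[a, b]%classic f -> bochner_class mu `[a', b']%classic f.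
Proof.
move=> aa bb; apply: bochner_classS; [exact: measurable_segment..|].
by apply: subset_itv; rewrite bnd_simp.
Qed.

Lemma Rintegral_split (f : R -> R) (a c b : R) : a <= c -> c <= b ->
  mu.-integrable `[a, b]%classic (EFin \o f) ->
  \int[mu]_(x in `[a, b]%classic) f x =
  \int[mu]_(x in `[a, c]%classic) f x + \int[mu]_(x in `[c, b]%classic) f x.
Proof.
move=> ac cb fi.
have := Rintegral_itvB (x := c) fi; rewrite !bnd_simp => /(_ ac cb).
rewrite Rintegral_itv_obnd_cbnd => [<-|]; first by rewrite addrC subrK.
apply: integrableS fi; [exact: measurable_itv|exact: measurable_itv|].
by apply: subset_itv; rewrite bnd_simp.
Qed.

Lemma bochner_integral_split (f : R -> E) (a c b : R) : a <= c -> c <= b ->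
  bochner_class mu `[a, b]%classic f ->
  bochner_integral mu `[a, b]%classic f =
  bochner_integral mu `[a, c]%classic f + bochner_integral mu `[c, b]%classic f.
Proof.
move=> ac cb cf; apply: (@weak_bochnerE _ _ _ mu _ P _ f _ (measurable_segment a b) cf).
have c1 := bochner_class_sub (lexx a) cb cf.
have c2 := bochner_class_sub ac (lexx b) cf.
have := (@bochnerP _ _ _ mu _ P _ f (measurable_segment a b) cf).2.
have := (@bochnerP _ _ _ mu _ P _ f (measurable_segment a c) c1).2.
have := (@bochnerP _ _ _ mu _ P _ f (measurable_segment c b) c2).2.
move=> w1 w2 w3 h; split; first exact: (w3 h).1.
by rewrite (Rintegral_split ac cb (w3 h).1) (w2 h).2 (w1 h).2 ipDr.
Qed.

Lemma Rintegral_translate (f : R -> R) (a h : R) : 0 <= h -> continuous f ->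
  \int[mu]_(s in `[a, a + h]%classic) f (a + h - s) =
  \int[mu]_(s in `[0, h]%classic) f (h - s).
Proof.
move=> h0 cf.
pose F (x : R) := x + a; pose G s := f (a + h - s).
have F' : derive1 F = cst 1.
  by apply/funext => x; rewrite derive1E deriveD// derive_id derive_cst addr0.
have := @integration_by_substitution_increasing R F G 0 h h0.
rewrite /F add0r addrC F' => H; rewrite /Rintegral H.
- congr fine; apply: eq_integral => x _; congr EFin.
  by rewrite /G !fctE mulr1; congr f; rewrite opprD addrA addrAC; ring.
- by move=> x y _ _; rewrite ltrD2r.
- by move=> x _; exact: cvg_cst.
- exact: is_cvg_cst.
- exact: is_cvg_cst.
- split.
  + by move=> x _; apply: derivableD.
  + by apply: cvg_at_right_filter; apply: cvgD; [exact: cvg_id|exact: cvg_cst].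
  + by apply: cvg_at_left_filter; apply: cvgD; [exact: cvg_id|exact: cvg_cst].
- apply: continuous_subspaceT => x; rewrite /G.
  apply: continuous_comp; last exact: cf.
  by apply: continuousB; [exact: cvg_cst|exact: cvg_id].
Qed.

Lemma const_bochner_class (a b : R) (w : E) : 0 <= a ->
  bochner_class mu `[a, b]%classic (fun=> w).
Proof.
move=> a0; split.
  apply: step_limitS (step_limit_grid (fun=> w) 0 b).
  by apply: subset_itv; rewrite bnd_simp.
apply: (@bounded_integrable _ _ _ mu _ _ `|w|).
- exact: measurable_segment.
- exact: finite_segment.
- exact: measurable_cst.
- by move=> x _; rewrite normr_id.
Qed.

Lemma const_weak_integral (h : R) (w : E) : 0 <= h ->
  weak_integral mu P `[0, h]%classic (fun=> w) (h *: w).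
Proof.
move=> h0 k; split.
  exact: (@bounded_integrable _ _ _ mu _ _ `|P k w| (measurable_segment 0 h)
    (finite_segment 0 h)).
by rewrite Rintegral_cst_itv// subr0 ipZr.
Qed.

End bochner_interval.

Section mild.
Variables (R : realType) (E : completeNormedModType R).
Variable P : real_inner_product E.
Variables (S : R -> {linear E -> E}) (hS : c0_semigroup S).
Notation mu := (@lebesgue_measure R).
Local Notation Sg := (Sg S).

(** The mild solution with forcing term [v], to be thought of as [B \o u]. *)
Definition mild (v : R -> E) (x0 : E) (t : R) : E :=
  Sg t x0 + bochner_integral mu `[0, t]%classic (fun s => Sg (t - s) (v s)).

Definition const_response (w : E) (h : R) : E :=
  bochner_integral mu `[0, h]%classic (fun s => Sg (h - s) w).

Lemma mild0 v x0 : mild v x0 0 = x0.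
Proof.
rewrite /mild Sg0// (@eq_bochner_integral _ _ _ mu _ _ _ (fun=> v 0)).
  rewrite (@weak_bochnerE _ _ _ mu _ P _ _ _ (measurable_segment 0 0)
    (const_bochner_class 0 (v 0) (lexx 0)) (const_weak_integral P (v 0) (lexx 0))).
  by rewrite scale0r addr0.
by move=> x; rewrite set_itv1 => ->; rewrite subrr Sg0.
Qed.

(** The integral is split at [a]; on the first part the integrand is the image
    under the bounded operator [Sg h] of the one at time [a]. *)
Lemma mild_cocycle v x0 a h : 0 <= a -> 0 <= h ->
  bochner_class mu `[0, a + h]%classic v ->
  mild v x0 (a + h) = Sg h (mild v x0 a) +
    bochner_integral mu `[a, a + h]%classic (fun s => Sg (a + h - s) (v s)).
Proof.
move=> a0 h0 cv; rewrite /mild linearD/= -SgD// (addrC h) -!addrA; congr (_ + _).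
have aah : a <= a + h by rewrite lerDl.
have cv' := bochner_class_sub (lexx 0) aah cv.
rewrite (bochner_integral_split P a0 aah (Sg_bochner_class hS (a + h) (lexx 0) cv)).
congr (_ + _).
have [M [M0 HM]] := Sg_bounded hS h.
have HM' x : `|Sg h x| <= M * `|x| by exact: HM.
rewrite -(@bochner_integral_linear _ _ _ mu _ _ P P (Sg h) M _ _ (measurable_segment 0 a)
   HM' (Sg_linear_continuous hS (t := h)) (Sg_bochner_class hS a (lexx 0) cv')).
apply: eq_bochner_integral => s; rewrite /= in_itv/= => /andP[s0 sa].
by rewrite -SgD ?subr_ge0//; congr (Sg _ _); ring.
Qed.

(** Tested against a vector, the two integrands are continuous real functions
    which differ by a translation of time. *)
Lemma const_response_translate w a h : 0 <= a -> 0 <= h ->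
  bochner_integral mu `[a, a + h]%classic (fun s => Sg (a + h - s) w) =
  const_response w h.
Proof.
move=> a0 h0.
have c1 := Sg_bochner_class hS (a + h) a0 (const_bochner_class (a + h) w a0).
have c2 := Sg_bochner_class hS h (lexx 0) (const_bochner_class h w (lexx 0)).
apply: (@weak_bochnerE _ _ _ mu _ P _ _ _ (measurable_segment a (a + h)) c1).
move=> k; have [i1 e1] := (@bochnerP _ _ _ mu _ P _ _ (measurable_segment a (a + h)) c1).2 k.
split => //.
rewrite -((@bochnerP _ _ _ mu _ P _ _ (measurable_segment 0 h) c2).2 k).2.
apply: (Rintegral_translate (f := fun r => P k (Sg r w))) => // r.
apply: (@continuous_comp _ _ _ (fun r => Sg r w) (P k)).
  exact: Sg_continuous.
exact: ip_continuous.
Qed.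

Lemma mild_const v x0 a h w : 0 <= a -> 0 <= h ->
  bochner_class mu `[0, a + h]%classic v ->
  (forall s, a <= s -> s < a + h -> v s = w) ->
  mild v x0 (a + h) = Sg h (mild v x0 a) + const_response w h.
Proof.
move=> a0 h0 cv vw; rewrite mild_cocycle//; congr (_ + _).
rewrite -(const_response_translate w a0 h0).
apply: (@bochner_integral_off_null _ _ _ mu _ [set a + h]).
- exact: measurable_set1.
- exact: lebesgue_measure_set1.
- move=> s; rewrite /= in_itv/= => /andP[h1 h2] h3.
  by rewrite vw// lt_neqAle h2 andbT; apply/eqP.
Qed.

Lemma mild_norm (v v' : R -> E) x0 x0' (b M t : R) : 0 <= t -> t <= b -> 0 <= M ->
  (forall r x, r <= b -> `|Sg r x| <= M * `|x|) ->
  bochner_class mu `[0, b]%classic v -> bochner_class mu `[0, b]%classic v' ->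
  `|mild v x0 t - mild v' x0' t| <= M * `|x0 - x0'| +
     M * \int[mu]_(s in `[0, b]%classic) `|v s - v' s|.
Proof.
move=> t0 tb M0 HM cv cv'; rewrite /mild opprD addrACA.
rewrite (le_trans (ler_normD _ _))// lerD//; first by rewrite -linearB HM.
have c1 := bochner_class_sub (lexx 0) tb cv.
have c2 := bochner_class_sub (lexx 0) tb cv'.
have m0t := measurable_segment 0 t; have m0b := measurable_segment 0 b.
have i1 := (@bochnerP _ _ _ mu _ P _ _ m0t (Sg_bochner_class hS t (lexx 0) c1)).2.
have i2 := (@bochnerP _ _ _ mu _ P _ _ m0t (Sg_bochner_class hS t (lexx 0) c2)).2.
have ib : mu.-integrable `[0, b]%classic (EFin \o (fun s => `|v s - v' s|)).
  apply: (@le_integrable_real _ _ _ mu _ _ (fun s => `|v s| + `|v' s|)) => //.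
  - apply: (step_limit_norm (mu := mu)) => //.
    by apply: step_limitB; [case: cv|case: cv'].
  - by move=> x _; rewrite normr_id ler_normB.
  - by apply: integrable_realD => //; [case: cv|case: cv'].
have it : mu.-integrable `[0, t]%classic (EFin \o (fun s => `|v s - v' s|)).
  by apply: integrableS ib => //; apply: subset_itv; rewrite bnd_simp.
have le1 := @weak_integral_norm _ _ _ mu _ P _ _ _ _ m0t
  (@weak_integralB _ _ _ mu _ P _ _ _ _ _ m0t i1 i2)
  (@integrable_realZ _ _ _ mu _ M _ m0t it).
rewrite (le_trans (le1 _))//.
  move=> s; rewrite /= in_itv/= => /andP[s0 st].
  by rewrite -linearB HM// (le_trans _ tb)// gerBl.
rewrite RintegralZl// ler_wpM2l// (Rintegral_split t0 tb ib) lerDl.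
exact: Rintegral_ge0.
Qed.

(** On [0, b] this is [mild v x0], see [mild_extE].  The domain of integration
    does not depend on [t], which is what dominated convergence needs, and
    continuity holds on the whole line. *)
Definition mild_ext (b : R) (v : R -> E) (x0 : E) (t : R) : E :=
  Sg t x0 + bochner_integral mu `[0, b]%classic
     (fun s => (\1_(`]-oo, t]%classic) s : R) *: Sg (t - s) (v s)).

Lemma mild_ext_class b v t : bochner_class mu `[0, b]%classic v ->
  bochner_class mu `[0, b]%classic
     (fun s => (\1_(`]-oo, t]%classic) s : R) *: Sg (t - s) (v s)).
Proof.
move=> cv; have [l1 i1] := Sg_bochner_class hS t (lexx 0) cv.
have ms : measurable (`]-oo, t]%classic : set R) by exact: measurable_itv.
have l2 : step_limit mu `[0, b]%classic
     (fun s => (\1_(`]-oo, t]%classic) s : R) *: Sg (t - s) (v s)).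
  by apply: step_limit_restrict => //; apply: step_limitS l1 => x [].
split => //; apply: le_integrable_real i1; first exact: measurable_segment.
  by apply: (step_limit_norm (mu := mu)) => //; exact: measurable_segment.
move=> s _; rewrite normr_id normrZ indicE.
by case: (s \in _); rewrite ?normr1 ?mul1r// normr0 mul0r.
Qed.

Lemma mild_extE b v x0 t : 0 <= t -> t <= b ->
  bochner_class mu `[0, b]%classic v -> mild_ext b v x0 t = mild v x0 t.
Proof.
move=> t0 tb cv; congr (_ + _).
apply: (@weak_bochnerE _ _ _ mu _ P _ _ _ (measurable_segment 0 b)
  (mild_ext_class t cv)).
have c1 := Sg_bochner_class hS t (lexx 0) (bochner_class_sub (lexx 0) tb cv).
move=> k; have [_ e1] := (@bochnerP _ _ _ mu _ P _ _ (measurable_segment 0 t) c1).2 k.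
have [i2 _] := (@bochnerP _ _ _ mu _ P _ _ (measurable_segment 0 b) (mild_ext_class t cv)).2 k.
split => //; rewrite -e1.
have -> : (`[0, t]%classic : set R) = `[0, b]%classic `&` `]-oo, t]%classic.
  apply/seteqP; split => x; rewrite /= !in_itv/=.
    by move=> /andP[-> h]; split => //=; rewrite (le_trans h).
  by move=> [/andP[-> _] ->].
rewrite Rintegral_mkcondr; apply: eq_Rintegral => s _.
rewrite patchE ipZr indicE; case: (s \in _) => /=; first by rewrite mul1r.
by rewrite mul0r.
Qed.

(** When [t_n] tends to [t], the integrands converge at every time but [t],
    and they are dominated by a multiple of the norm of [v]. *)
Lemma mild_ext_continuous b v x0 : bochner_class mu `[0, b]%classic v ->
  continuous (mild_ext b v x0).
Proof.
move=> cv t; apply: cvgD; first exact: Sg_continuous.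
have mb := measurable_segment 0 b.
apply: cvg_from_seq => u ut.
have [C HC] : exists C, forall n, u n <= C.
  have /cvg_seq_bounded[C [_ HC]] : cvgn u by apply/cvg_ex; exists t.
  exists (C + 1) => n; rewrite (le_trans (ler_norm _))// (HC (C + 1))//.
  by rewrite ltrDl.
have [M [M0 HM]] := Sg_bounded hS (Num.max C t).
pose f r s : E := (\1_(`]-oo, r]%classic) s : R) *: Sg (r - s) (v s).
have cf r : bochner_class mu `[0, b]%classic (f r) by exact: mild_ext_class.
have wf r := (@bochnerP _ _ _ mu _ P _ _ mb (cf r)).2.
have mB n : measurable_fun (`[0, b]%classic : set R) (fun s => `|f (u n) s - f t s|).
  apply: (step_limit_norm (mu := mu)) => //.
  by apply: step_limitB; [case: (cf (u n))|case: (cf t)].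
have fM r s : s >= 0 -> r <= Num.max C t -> `|f r s| <= M * `|v s|.
  move=> s0 rC; rewrite normrZ indicE; case: (s \in _); last first.
    by rewrite normr0 mul0r mulr_ge0// ltW.
  by rewrite normr1 mul1r HM// (le_trans _ rC)// gerBl.
have gi : mu.-integrable `[0, b]%classic (EFin \o (fun s => (2 * M) * `|v s|)).
  by apply: integrable_realZ => //; case: cv.
have dom n s : `[0, b]%classic s -> `| `|f (u n) s - f t s| | <= (2 * M) * `|v s|.
  rewrite /= in_itv/= => /andP[s0 _]; rewrite normr_id.
  rewrite (le_trans (ler_normB _ _))//.
  have := fM (u n) s s0; rewrite le_max HC => /(_ isT).
  have := fM t s s0; rewrite le_max lexx orbT => /(_ isT); lra.
have ptw s : `[0, b]%classic s -> ~ [set t] s ->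
    `|f (u n) s - f t s| @[n --> \oo] --> (0 : R).
  move=> _ /= /eqP st; rewrite -(normr0 E) -[X in `|X|](subrr (f t s)).
  apply: cvg_norm; apply: cvgB; last exact: cvg_cst.
  have [lt_st|lt_ts|eq_st] := ltgtP s t; last by rewrite eq_st eqxx in st.
    have -> : f t s = Sg (t - s) (v s).
      by rewrite /f indicE mem_set ?scale1r//= in_itv/= ltW.
    have : Sg (u n - s) (v s) @[n --> \oo] --> Sg (t - s) (v s).
      apply: (@continuous_cvg _ _ _ _ _ _ (fun r => Sg r (v s))).
        exact: Sg_continuous.
      by apply: cvgB => //; exact: cvg_cst.
    apply: cvg_trans; apply: near_eq_cvg; near=> n.
    rewrite /f indicE mem_set ?scale1r//= in_itv/= ltW//.
    by near: n; apply: cvgr_gt ut _ _.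
  have -> : f t s = 0.
    by rewrite /f indicE memNset ?scale0r//= in_itv/= leNgt lt_ts.
  apply: cvg_near_cst; near=> n.
  rewrite /f indicE memNset ?scale0r//= in_itv/= leNgt; apply/negP; rewrite negbK.
  by near: n; apply: cvgr_lt ut _ _.
have c0 := @Rdominated_cvg0_ae _ _ _ mu _ _ _ _ mb (measurable_set1 t)
  (lebesgue_measure_set1 t) mB ptw gi dom.
pose I r : E := bochner_integral mu `[0, b]%classic (f r).
apply/(subr_cvg0 (fun n => I (u n)) (I t)); apply: norm_cvg0.
apply: (@squeeze_cvgr _ _ _ _ (cst 0)
  (fun n => \int[mu]_(s in `[0, b]%classic) `|f (u n) s - f t s|)); last 2 first.
- exact: cvg_cst.
- exact: c0.
apply: nearW => n; rewrite normr_ge0/=.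
have ii : mu.-integrable `[0, b]%classic (EFin \o (fun s => `|f (u n) s - f t s|)).
  exact: (@le_integrable_real _ _ _ mu _ _ _ mb (mB n) (dom n) gi).
by apply: (@weak_integral_norm _ _ _ mu _ P _ _ _ _ mb
  (@weak_integralB _ _ _ mu _ P _ _ _ _ _ mb (wf (u n)) (wf t)) ii).
Unshelve. all: by end_near. Qed.

End mild.

(** * The generator *)
Section generator.
Variables (R : realType) (E : completeNormedModType R).
Variable P : real_inner_product E.
Variables (S : R -> {linear E -> E}) (hS : c0_semigroup S).
Notation mu := (@lebesgue_measure R).
Local Notation Sg := (Sg S).

(** The pair [(x, y)] is in the graph of the generator of [S]. *)
Definition in_generator (x y : E) := h^-1 *: (Sg h x - x) @[h --> (0 : R)^'+] --> y.

Lemma in_generator_Sg t x y : 0 <= t -> in_generator x y -> in_generator (Sg t x) (Sg t y).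
Proof.
move=> t0 gxy.
have : Sg t (h^-1 *: (Sg h x - x)) @[h --> (0 : R)^'+] --> Sg t y.
  by apply: continuous_cvg gxy; exact: Sg_linear_continuous.
rewrite /in_generator; apply: cvg_trans; apply: near_eq_cvg; near=> h.
have h0 : 0 <= h by near: h; exact: nbhs_right_ge.
by rewrite linearZ/= linearB/= -(SgD hS _ t0 h0) (addrC t)
  (SgD hS _ h0 t0).
Unshelve. all: by end_near. Qed.

Lemma in_generatorD x y x' y' : in_generator x y -> in_generator x' y' -> in_generator (x + x') (y + y').
Proof.
move=> g g'.
have : h^-1 *: (Sg h x - x) + h^-1 *: (Sg h x' - x') @[h --> (0 : R)^'+]
  --> y + y' by apply: cvgD.
apply: cvg_trans; apply: near_eq_cvg; near=> h.
by rewrite [Sg h (x + x')]linearD opprD addrACA -scalerDr.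
Unshelve. all: by end_near. Qed.

Lemma const_response_right w :
  h^-1 *: const_response S w h @[h --> (0 : R)^'+] --> w.
Proof.
apply/cvgrPdist_le => e e0.
have /cvgrPdist_le/(_ _ e0)/nbhs_ballP[d /= d0 Hd] :=
  @Sg_continuous _ _ _ hS w 0.
near=> h; have h0 : 0 < h by near: h; exact: nbhs_right_gt.
have h0' := ltW h0.
have hd : h < d by near: h; exact: nbhs_right_lt.
have m0 := measurable_segment 0 h.
have cw := Sg_bochner_class hS h (lexx 0) (const_bochner_class h w (lexx 0)).
have := @weak_integral_norm _ _ _ mu _ P _ _ _ (cst e) m0
  (@weak_integralB _ _ _ mu _ P _ _ _ _ _ m0 (const_weak_integral P w (ltW h0))
    ((@bochnerP _ _ _ mu _ P _ _ m0 cw).2)) _ _.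
rewrite (Rintegral_cst_itv e h0') subr0.
rewrite -/(const_response S w h) => H.
rewrite -(ler_pM2l h0) -{1}(gtr0_norm h0) -normrZ scalerBr.
rewrite scalerA divff ?gt_eqF// scale1r; apply: H.
  apply: (@bounded_integrable _ _ _ mu _ _ `|e| m0 (finite_segment 0 h)) => //.
move=> s; rewrite /= in_itv/= => /andP[s0 sh].
rewrite -{1}(Sg0 hS w); apply: Hd.
rewrite /ball/= sub0r normrN ger0_norm ?subr_ge0//.
by rewrite (le_lt_trans _ hd)// gerBl.
Unshelve. all: by end_near. Qed.

Lemma mild_cst_response w t : mild S (fun=> w) 0 t = const_response S w t.
Proof. by rewrite /mild linear0 add0r. Qed.

Lemma const_response_add w a h : 0 <= a -> 0 <= h ->
  const_response S w (a + h) =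
  Sg h (const_response S w a) + const_response S w h.
Proof.
move=> a0 h0; rewrite -(mild_cst_response w (a + h)) -(mild_cst_response w a).
exact: (@mild_const _ _ P _ hS (fun=> w) 0 a h w a0 h0
  (const_bochner_class (a + h) w (lexx 0)) (fun _ _ _ => erefl)).
Qed.

(** Let [j] be the constant response.  Computing [j (t + h)] in two ways with
    [const_response_add] gives [Sg h (j t) - j t = Sg t (j h) - j h], and
    [j h / h] tends to [w]. *)
Lemma in_generator_const_response w t : 0 <= t ->
  in_generator (const_response S w t) (Sg t w - w).
Proof.
move=> t0.
have : Sg t (h^-1 *: const_response S w h) - h^-1 *: const_response S w h
    @[h --> (0 : R)^'+] --> Sg t w - w.
  apply: cvgB; last exact: const_response_right.
  apply: (@continuous_cvg _ _ _ _ _ _ (Sg t)); first exact: Sg_linear_continuous.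
  exact: const_response_right.
rewrite /in_generator; apply: cvg_trans; apply: near_eq_cvg; near=> h.
have h0 : 0 <= h by near: h; exact: nbhs_right_ge.
rewrite linearZ/= -scalerBr; congr (h^-1 *: _).
have := const_response_add w t0 h0; rewrite addrC const_response_add//.
by move=> e; apply/eqP; rewrite subr_eq addrAC -e addrK.
Unshelve. all: by end_near. Qed.

(** The constant responses are in the domain of the generator, and
    [const_response S x h] divided by [h] tends to [x]. *)
Lemma in_generator_dense x (e : R) : 0 < e -> exists x' y', in_generator x' y' /\ `|x - x'| <= e.
Proof.
move=> e0; have /cvgrPdist_le/(_ _ e0) := @const_response_right x.
move=> H; near (0 : R)^'+ => h; have h0 : 0 <= h by near: h; exact: nbhs_right_ge.
exists (h^-1 *: const_response S x h), (h^-1 *: (Sg h x - x)); split; last first.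
  by near: h.
have : h^-1 *: (r^-1 *: (Sg r (const_response S x h) - const_response S x h))
    @[r --> (0 : R)^'+] --> h^-1 *: (Sg h x - x).
  by apply: cvgZr; exact: in_generator_const_response.
apply: cvg_trans.
apply: near_eq_cvg; near=> r.
by rewrite [Sg r (h^-1 *: _)]linearZ/= -scalerBr !scalerA mulrC.
Unshelve. all: by end_near. Qed.

Lemma const_control_right x y w : in_generator x y ->
  h^-1 *: (Sg h x + const_response S w h - x) @[h --> (0 : R)^'+] --> y + w.
Proof.
move=> g.
have : h^-1 *: (Sg h x - x) + h^-1 *: const_response S w h @[h --> (0 : R)^'+]
  --> y + w by apply: cvgD => //; exact: const_response_right.
apply: cvg_trans.
by apply: near_eq_cvg; near=> h; rewrite -scalerDr addrAC.
Unshelve. all: by end_near. Qed.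

End generator.

Section chain_rule.
Variables (R : realType) (E : normedModType R) (V : E -> R).

Lemma right_chain_rule (c : R -> E) (x y : E) (e : R) : differentiable V x ->
  h^-1 *: (c h - x) @[h --> (0 : R)^'+] --> y -> 0 < e ->
  \forall h \near (0 : R)^'+, `|V (c h) - V x - h * 'd V x y| <= h * e.
Proof.
move=> dV cxy e0; have cd : continuous ('d V x) by exact: diff_continuous.
pose e1 := e / 2 / (`|y| + 1).
have y0 : 0 < `|y| + 1 by rewrite ltr_wpDl.
have e20 : 0 < e / 2 by rewrite divr_gt0.
have e10 : 0 < e1 by rewrite divr_gt0.
have /eqaddoP/(_ _ e10)/nbhs_ballP[d /= d0 Hd] := diff_locally dV.
have dy : 'd V x (h^-1 *: (c h - x)) @[h --> (0 : R)^'+] --> 'd V x y.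
  by apply: continuous_cvg cxy; exact: cd.
near=> h; have h0 : 0 < h by near: h; exact: nbhs_right_gt.
have k1 : `|h^-1 *: (c h - x)| <= `|y| + 1.
  rewrite -[X in `|X|](subrK y) (le_trans (ler_normD _ _))// addrC lerD2l.
  by rewrite distrC; near: h; apply: cvgr_dist_le cxy _ _.
have kh : `|c h - x| <= h * (`|y| + 1).
  by rewrite -ler_pdivrMl//; move: k1; rewrite normrZ normfV (gtr0_norm h0).
have hd : h * (`|y| + 1) < d.
  by rewrite -ltr_pdivlMr//; near: h; apply: nbhs_right_lt; rewrite divr_gt0.
have /Hd : ball 0 d (c h - x).
  by rewrite -ball_normE/= /ball_/= sub0r normrN (le_lt_trans kh).
rewrite !fctE/= subrK => h1.
have h2 : `|'d V x y - 'd V x (h^-1 *: (c h - x))| <= e / 2.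
  by near: h; apply: cvgr_dist_le dy _ _.
have E1 : V (c h) - V x - h * 'd V x y =
   (V (c h) - (V x + 'd V x (c h - x))) -
   h * ('d V x y - 'd V x (h^-1 *: (c h - x))).
  rewrite [in 'd V x (h^-1 *: _)]linearZ/= mulrBr.
  rewrite [X in _ - (_ - X)](_ : _ = 'd V x (c h - x)); first by ring.
  by rewrite /GRing.scale/= mulrA divff ?gt_eqF// mul1r.
have -> : h * e = h * (e / 2) + h * (e / 2) by field.
rewrite E1 (le_trans (ler_normB _ _))// lerD//.
  apply: (le_trans h1); rewrite (le_trans (ler_wpM2l (ltW e10) kh))//.
  by rewrite /e1 mulrCA divfK// gt_eqF.
by rewrite normrM (gtr0_norm h0) ler_pM2l.
Unshelve. all: by end_near. Qed.

End chain_rule.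

(** * Dissipation along grid controls *)
Section grid_control.
Variables (R : realType) (E : completeNormedModType R).
Variable P : real_inner_product E.
Variables (S : R -> {linear E -> E}) (hS : c0_semigroup S).
Notation mu := (@lebesgue_measure R).
Local Notation Sg := (Sg S).

Lemma grid_bounded (W : R -> R) N b :
  exists c, forall s, 0 <= s -> s <= b -> `|W (grid N s)| <= c.
Proof.
pose m := (Num.truncn (b * N.+1%:R)).+1.
exists (\sum_(j < m) `|W (j%:R / N.+1%:R)|) => s s0 sb.
have kb : (Num.truncn (s * N.+1%:R)%R < m)%N.
  by rewrite ltnS le_truncn// ler_pM2r.
by rewrite (bigD1 (Ordinal kb))//= lerDl; apply: sumr_ge0.
Qed.

Lemma grid_integrable (W : R -> R) N b :
  mu.-integrable `[0, b]%classic (EFin \o (fun s => W (grid N s))).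
Proof.
have [c Hc] := grid_bounded W N b.
apply: (@bounded_integrable _ _ _ mu _ _ c (measurable_segment 0 b) (finite_segment 0 b)).
  apply: (measurable_comp_step_limit (mu := mu) (phi := id)).
  - exact: measurable_segment.
  - exact: step_limit_grid.
  - by move=> x; exact: cvg_id.
by move=> s; rewrite /= in_itv/= => /andP[s0 sb]; exact: Hc.
Qed.

Lemma grid_bochner_class (W : R -> E) N b :
  bochner_class mu `[0, b]%classic (fun s => W (grid N s)).
Proof.
split; first exact: step_limit_grid.
exact: (grid_integrable (fun s => `|W s|)).
Qed.

Lemma grid_node N k s : k%:R / N.+1%:R <= s -> s < k.+1%:R / N.+1%:R ->
  grid N s = k%:R / N.+1%:R :> R.
Proof.
move=> h1 h2; congr (_%:R / _); apply: truncn_def.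
by rewrite -ler_pdivrMr// h1/= -ltr_pdivlMr.
Qed.

Variables (N : nat) (W : R -> E) (x0 : E).
Let v s := W (grid N s).
Let X := mild S v x0.

Lemma grid_mild_cell k h : 0 <= h -> h <= N.+1%:R^-1 ->
  X (k%:R / N.+1%:R + h) =
  Sg h (X (k%:R / N.+1%:R)) + const_response S (W (k%:R / N.+1%:R)) h.
Proof.
move=> h0 hN; apply: (mild_const P hS) => //.
- exact: grid_bochner_class.
- move=> s h1 h2; rewrite /v (grid_node h1)// (lt_le_trans h2)//.
  by rewrite -(natr1 k) mulrDl mul1r lerD2l.
Qed.

(** By induction on the nodes: within a cell, the solution is the sum of an orbit
    issued from the domain of the generator and of a constant response. *)
Lemma grid_mild_in_generator y0 : in_generator S x0 y0 ->
  forall t, 0 <= t -> exists y, in_generator S (X t) y.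
Proof.
move=> g0.
have cell k h : 0 <= h -> h <= N.+1%:R^-1 -> (exists y, in_generator S (X (k%:R / N.+1%:R)) y) ->
    exists y, in_generator S (X (k%:R / N.+1%:R + h)) y.
  move=> h0 hN [y gy]; rewrite grid_mild_cell//.
  eexists; apply: in_generatorD; first exact: (in_generator_Sg hS h0 gy).
  exact: in_generator_const_response.
have node k : exists y, in_generator S (X (k%:R / N.+1%:R)) y.
  elim: k => [|k IH]; first by rewrite mul0r /X mild0//; exists y0.
  by rewrite -(natr1 k) mulrDl mul1r; apply: cell.
move=> t t0; have := node (Num.truncn (t * N.+1%:R)).
move=> /(cell _ (t - grid N t)); rewrite subr_ge0 grid_le// => /(_ isT).
rewrite -/(grid N t) addrCA subrr addr0; apply.
by rewrite lerBlDl ltW// grid_gt.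
Qed.

Lemma grid_mild_right t : 0 <= t -> exists2 d : R, 0 < d &
  forall h, 0 <= h -> h < d ->
    X (t + h) = Sg h (X t) + const_response S (v t) h.
Proof.
move=> t0; have [d d0 Hd] := grid_right N t0; exists d; first exact: d0.
move=> h h0 hd; apply: (mild_const P hS) => //; first exact: grid_bochner_class.
move=> s ts sth; congr W; rewrite -[s](subrK t) addrC Hd ?subr_ge0//.
by rewrite (lt_trans _ hd)// ltrBlDl.
Qed.

End grid_control.

Section grid_inequality.
Variables (R : realType) (E : completeNormedModType R).
Variable P : real_inner_product E.
Variables (S : R -> {linear E -> E}) (hS : c0_semigroup S).
Variables (U : normedModType R) (B : U -> E) (V : E -> R) (G : E -> R) (L : U -> R).
Notation mu := (@lebesgue_measure R).
Hypothesis V_diff : forall x, differentiable V x.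
Hypothesis G_cont : continuous G.
Hypothesis pre_diss : forall x y u, in_generator S x y -> 'd V x (y + B u) <= G x + L u.

Variables (N : nat) (w : R -> U) (x0 y0 : E).
Hypothesis x0_dom : in_generator S x0 y0.
Let u s := w (grid N s).
Let X := mild S (fun s => B (u s)) x0.

(** By [const_control_right], the right derivative of [V \o X] at [t] is the
    derivative of [V] along [y + B (u t)], where [y] is the image of [X t] under
    the generator; it is at most [G (X t) + L (u t)], which is the right
    derivative of the integral. *)
Lemma grid_dissipation t1 t2 : 0 <= t1 -> t1 <= t2 ->
  V (X t2) - V (X t1) <=
  \int[mu]_(s in `[t1, t2]%classic) (G (X s) + L (u s)).
Proof.
move=> t10 t12.
have cV : continuous V by move=> x; exact: differentiable_continuous.
pose v s := B (u s).
have cv : bochner_class mu `[0, t2]%classic v.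
  exact: (grid_bochner_class (fun s => B (w s))).
(* An opaque copy of the solution, continuous on the whole line. *)
have [X' cX' XE] : exists2 X' : R -> E, continuous X' &
    forall t, 0 <= t -> t <= t2 -> X' t = X t.
  exists (mild_ext S t2 v x0); first exact: (mild_ext_continuous P hS).
  by move=> t h1 h2; apply: (mild_extE P hS).
pose om s := G (X' s) + L (u s).
have iG a b : mu.-integrable `[a, b]%classic (EFin \o (fun s => G (X' s))).
  apply: continuous_itv_integrable => s.
  by apply: continuous_comp; [exact: cX'|exact: G_cont].
have iom : mu.-integrable `[t1, t2]%classic (EFin \o om).
  apply: integrable_realD => //.
  have := grid_integrable (fun s => L (w s)) N t2.
  by apply: integrableS => //; apply: subset_itv; rewrite bnd_simp.
rewrite (@eq_Rintegral _ _ _ mu _ om); last first.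
  move=> s /set_mem; rewrite /= in_itv/= => /andP[s1 s2].
  by rewrite /om XE// (le_trans t10).
rewrite -!XE ?(le_trans t10)//.
have [I IE] : exists I, I = fun t => \int[mu]_(s in `[t1, t]%classic) om s.
  by eexists.
have cI : {within `[t1, t2], continuous I}.
  by rewrite IE; exact: parameterized_integral_continuous.
have I0 : I t1 = 0 by rewrite IE set_itv1; exact: Rintegral_set1.
have [g gE] : exists g, g = fun t => V (X' t) - I t by eexists.
suff : g t2 <= g t1.
  rewrite gE I0 subr0 lerBlDr => h; rewrite lerBlDl (le_trans h)// IE addrC.
  exact: lexx.
apply: dini_nonincreasing => //.
  rewrite gE => t; apply: cvgB; last exact: cI.
  apply: (@continuous_subspaceT _ _ _ (V \o X')) => s.
  by apply: continuous_comp; [exact: cX'|exact: cV].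
move=> t e t1t tt2 e0.
have t0 : 0 <= t by rewrite (le_trans t10).
have e20 : 0 < e / 2 by rewrite divr_gt0.
have [y gy] := grid_mild_in_generator P hS N (fun s => B (w s)) x0_dom t0.
have [d1 d10 Hd1] := grid_mild_right P hS N (fun s => B (w s)) x0 t0.
have [d2 d20 Hd2] := grid_right N t0.
have := @const_control_right _ _ P _ hS _ _ (v t) gy.
move=> /(right_chain_rule (V_diff _)) /(_ e20).
rewrite near_withinE => /nbhs_ballP[d3 /= d30 Hd3].
have /cvgrPdist_le/(_ _ e20)/nbhs_ballP[d4 /= d40 Hd4] :
    G (X' s) @[s --> t] --> G (X' t).
  by apply: continuous_comp; [exact: cX'|exact: G_cont].
exists (Num.min (Num.min d1 d2) (Num.min d3 d4)); first by rewrite !lt_min d10 d20 d30.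
move=> h h0; rewrite !lt_min => /andP[/andP[hd1 hd2] /andP[hd3 hd4]] hb.
have h0' := ltW h0.
have := Hd3 h; rewrite /ball/= sub0r normrN gtr0_norm// => /(_ hd3 h0).
rewrite -Hd1// => /ler_normlW.
have pd := pre_diss (w (grid N t)) gy.
have th : t <= t + h by rewrite lerDl.
have tth : 0 <= t + h by rewrite (le_trans t0).
have -> : g (t + h) - g t = V (X' (t + h)) - V (X' t) -
    \int[mu]_(s in `[t, t + h]%classic) om s.
  rewrite gE.
  have -> : I (t + h) = I t + \int[mu]_(s in `[t, t + h]%classic) om s.
    rewrite IE; apply: Rintegral_split => //.
    by apply: integrableS iom => //; apply: subset_itv; rewrite bnd_simp.
  have aux (p q r q' : R) : p - (r + q) - (q' - r) = p - q' - q by ring.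
  exact: aux.
(* Past [t], the control keeps its value for a while and [G \o X'] moves by at
   most [e / 2]. *)
have lowint : h * (G (X' t) + L (u t) - e / 2) <=
    \int[mu]_(s in `[t, t + h]%classic) om s.
  have -> : h * (G (X' t) + L (u t) - e / 2) =
      \int[mu]_(s in `[t, t + h]%classic) (G (X' t) + L (u t) - e / 2).
    by rewrite Rintegral_cst_itv// [t + h]addrC addrK.
  apply: le_Rintegral => //.
  - exact: (@bounded_integrable _ _ _ mu _ _ `|G (X' t) + L (u t) - e / 2|
      (measurable_segment t (t + h)) (finite_segment t (t + h))).
  - by apply: integrableS iom => //; apply: subset_itv; rewrite bnd_simp.
  - move=> s; rewrite /= in_itv/= => /andP[ts sth].
    have s0 : 0 <= s - t by rewrite subr_ge0.
    have sh : s - t <= h by rewrite lerBlDl.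
    have us : u s = u t.
      by rewrite /u -[s](subrK t) addrC Hd2// (le_lt_trans sh).
    have : `|G (X' t) - G (X' s)| <= e / 2.
      by apply: Hd4; rewrite /ball/= distrC ger0_norm// (le_lt_trans sh).
    by rewrite /om us => /ler_normlW; lra.
have ttE : X' (t + h) = X (t + h) by exact: XE.
have tE : X' t = X t by apply: XE => //; exact: ltW.
rewrite ttE; rewrite tE in lowint *; rewrite -/(X t) -/(v t) in pd *.
move: lowint pd; set I1 := Rintegral _ _ _; set a := V _; set b := V (X t).
set c := 'd V _ _; set p := G _; set q := L _.
rewrite -/q; move: I1 a b c p q => {}I1 {}a {}b {}c {}p {}q.
move=> h1 h2 h3.
have : h * c <= h * (p + q) by rewrite ler_pM2l.
lra.
Qed.

End grid_inequality.

(** * Dissipation along square integrable controls *)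
Section L2_products.
Context d (T : measurableType d) (R : realType).
Variable mu : {measure set T -> \bar R}.

(** Instead of the Cauchy-Schwarz inequality for integrals, use that
    [f * phi <= eta * phi ^+ 2 + eta^-1 * f ^+ 2], first choosing [eta] small
    and then [n] large. *)
Lemma product_cvg0 (D : set T) (f : nat -> T -> R) (phi : T -> R) :
  measurable D -> (forall n x, 0 <= f n x) -> (forall x, 0 <= phi x) ->
  (forall n, measurable_fun D (f n)) -> measurable_fun D phi ->
  (forall n, mu.-integrable D (EFin \o (fun x => f n x ^+ 2))) ->
  mu.-integrable D (EFin \o (fun x => phi x ^+ 2)) ->
  \int[mu]_(x in D) (f n x ^+ 2) @[n --> \oo] --> (0 : R) ->
  (forall n, mu.-integrable D (EFin \o (fun x => f n x * phi x))) /\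
  \int[mu]_(x in D) (f n x * phi x) @[n --> \oo] --> (0 : R).
Proof.
move=> mD f0 p0 mf mp i_f ip cf.
have le (eta : R) n x : 0 < eta ->
    f n x * phi x <= eta * phi x ^+ 2 + eta^-1 * f n x ^+ 2.
  move=> eta0; rewrite -subr_ge0.
  rewrite (_ : _ - _ = eta^-1 * ((eta * phi x - f n x) ^+ 2
    + eta * (f n x * phi x))); last by field; rewrite gt_eqF.
  rewrite mulr_ge0 ?invr_ge0 ?(ltW eta0)// addr_ge0 ?sqr_ge0//.
  by rewrite mulr_ge0 ?(ltW eta0)// mulr_ge0.
have ii n : mu.-integrable D (EFin \o (fun x => f n x * phi x)).
  apply: (@le_integrable_real _ _ _ mu _ _
    (fun x => 1 * phi x ^+ 2 + 1^-1 * f n x ^+ 2)) => //.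
  - exact: measurable_funM.
  - by move=> x _; rewrite ger0_norm ?mulr_ge0//; exact: le.
  - by apply: integrable_realD => //; exact: integrable_realZ.
split => //.
have I0 : 0 <= \int[mu]_(x in D) (phi x ^+ 2).
  by apply: Rintegral_ge0 => x _; exact: sqr_ge0.
set I := Rintegral _ _ _ in I0.
apply/cvgr0Pnorm_le => e e0.
pose eta := e / 2 / (I + 1).
have I1 : 0 < I + 1 by rewrite ltr_wpDl.
have eta0 : 0 < eta by rewrite divr_gt0// divr_gt0.
have e'0 : 0 < eta * (e / 2) by rewrite mulr_gt0// divr_gt0.
have /cvgr0Pnorm_le/(_ _ e'0) := cf; apply: filterS => n.
move=> /ler_normlW fn; rewrite ger0_norm; last first.
  by apply: Rintegral_ge0 => x _; exact: mulr_ge0.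
apply: (@le_trans _ _ (\int[mu]_(x in D)
    (eta * phi x ^+ 2 + eta^-1 * f n x ^+ 2))).
  apply: le_Rintegral => //; last by move=> x _; exact: le.
  by apply: integrable_realD => //; exact: integrable_realZ.
rewrite RintegralD//; [|exact: integrable_realZ..].
rewrite !RintegralZl// [leRHS]splitr lerD//.
  rewrite /eta -(mulrA (e / 2)) ler_piMr//; first by rewrite divr_ge0// ltW.
  by rewrite mulrC ler_pdivrMr// mul1r lerDl.
by rewrite mulrC ler_pdivrMr// mulrC.
Qed.

End L2_products.

Lemma sqr_affine_le (R : realType) (a : R) : (1 + 2 * a) ^+ 2 <= 2 + 8 * a ^+ 2.
Proof. by have := sqr_ge0 (2 * a - 1); lra. Qed.

Section general_control.
Variables (R : realType) (E : completeNormedModType R).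
Variable P : real_inner_product E.
Variables (S : R -> {linear E -> E}) (hS : c0_semigroup S).
Variables (U : normedModType R) (B : {linear U -> E}) (MB : R).
Variables (V : E -> R) (G : E -> R) (L : U -> R) (cL : R).
Notation mu := (@lebesgue_measure R).
Hypothesis B_bounded : forall x, `|B x| <= MB * `|x|.
Hypothesis V_diff : forall x, differentiable V x.
Hypothesis G_cont : continuous G.
Hypothesis G_bounded : forall r, exists c, forall x, `|x| <= r -> `|G x| <= c.
Hypothesis L_quadratic : forall u u',
  `|L u - L u'| <= cL * (`|u - u'| * (1 + `|u| + `|u'|)).

Lemma quadratic_continuous : continuous L.
Proof.
move=> u; apply/cvgrPdist_le => e e0.
pose c := `|cL| * (2 + 2 * `|u|) + 1.
have c0 : 0 < c by rewrite ltr_wpDl// mulr_ge0// addr_ge0// mulr_ge0.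
near=> u'; rewrite (le_trans (L_quadratic _ _))//.
have h1 : `|u - u'| <= 1 by near: u'; apply: cvgr_dist_le.
have h2 : `|u - u'| <= e / c.
  by near: u'; apply: cvgr_dist_le => //; rewrite divr_gt0.
have h3 : `|u'| <= `|u| + 1.
  by rewrite -[u'](subKr u) (le_trans (ler_normB _ _))// lerD2l.
have n0 := normr_ge0 (u - u').
apply: (@le_trans _ _ (`|u - u'| * c)); last by rewrite -ler_pdivlMr.
rewrite mulrCA ler_wpM2l//; apply: (@le_trans _ _ (`|cL| * (1 + `|u| + `|u'|))).
  by rewrite ler_wpM2r ?ler_norm// !addr_ge0.
rewrite /c; apply: (@le_trans _ _ (`|cL| * (2 + 2 * `|u|))); last by rewrite lerDl.
by rewrite ler_wpM2l//; lra.
Unshelve. all: by end_near. Qed.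

Lemma square_integrable_bochner_class (b : R) (u : R -> U) : step_limit mu `[0, b]%classic u ->
  mu.-integrable `[0, b]%classic (EFin \o (fun s => `|u s| ^+ 2)) ->
  bochner_class mu `[0, b]%classic u.
Proof.
move=> lu iu; split => //.
apply: (@le_integrable_real _ _ _ mu _ _ (fun s => 1 + `|u s| ^+ 2)).
- exact: measurable_segment.
- exact: (@step_limit_norm _ _ _ mu _ _ _ (measurable_segment 0 b) lu).
- move=> s _; rewrite normr_id; have := sqr_ge0 (`|u s| - 1).
  by rewrite sqrrB1; have := normr_ge0 (u s); nra.
- apply: integrable_realD => //.
  exact: (@bounded_integrable _ _ _ mu _ _ `|1| (measurable_segment 0 b) (finite_segment 0 b)).
Qed.

Lemma control_bochner_class (b : R) (u : R -> U) :
  bochner_class mu `[0, b]%classic u ->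
  bochner_class mu `[0, b]%classic (B \o u).
Proof.
exact: (@bochner_class_linear _ _ _ mu _ _ B MB _ _ (measurable_segment 0 b)
  B_bounded (bounded_linear_continuous B_bounded)).
Qed.

Lemma quadratic_integrable (b : R) (u : R -> U) : step_limit mu `[0, b]%classic u ->
  mu.-integrable `[0, b]%classic (EFin \o (fun s => `|u s| ^+ 2)) ->
  mu.-integrable `[0, b]%classic (EFin \o (fun s => L (u s))).
Proof.
move=> lu iu; have [_ iu1] := square_integrable_bochner_class lu iu.
have mb := measurable_segment 0 b.
apply: (@le_integrable_real _ _ _ mu _ _
  (fun s => `|L 0| + `|cL| * (`|u s| + `|u s| ^+ 2))) => //.
- apply: (measurable_comp_step_limit (mu := mu) (phi := L)) => //.
  exact: quadratic_continuous.
- move=> s _; have := L_quadratic (u s) 0; rewrite subr0 normr0 addr0 => h.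
  rewrite -[X in `|X|](subrK (L 0)) (le_trans (ler_normD _ _))// addrC lerD2l.
  by rewrite (le_trans h)// mulrDr mulr1 -expr2 ler_wpM2r ?ler_norm.
- apply: integrable_realD => //.
    exact: (@bounded_integrable _ _ _ mu _ _ `| `|L 0| | mb (finite_segment 0 b)).
  by apply: integrable_realZ => //; exact: integrable_realD.
Qed.

(** Approximate [x0] by states in the domain of the generator and [u] in L2 by
    grid controls, and pass to the limit in [grid_dissipation]. *)
Lemma L2_dissipation :
  (forall x y u, in_generator S x y -> 'd V x (y + B u) <= G x + L u) ->
  forall (x0 : E) (u : R -> U) t1 t2, 0 <= t1 -> t1 <= t2 ->
  step_limit mu `[0, t2]%classic u ->
  mu.-integrable `[0, t2]%classic (EFin \o (fun s => `|u s| ^+ 2)) ->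
  V (mild S (B \o u) x0 t2) - V (mild S (B \o u) x0 t1) <=
  \int[mu]_(s in `[t1, t2]%classic) (G (mild S (B \o u) x0 s) + L (u s)).
Proof.
move=> pre_diss x0 u t1 t2 t10 t12 lu iu.
have t20 : 0 <= t2 by rewrite (le_trans t10).
have mb := measurable_segment 0 t2; have m12 := measurable_segment t1 t2.
have sub12 : `[t1, t2]%classic `<=` (`[0, t2]%classic : set R).
  by apply: subset_itv; rewrite bnd_simp.
have intS f : mu.-integrable `[0, t2]%classic (EFin \o f) ->
    mu.-integrable `[t1, t2]%classic (EFin \o f) by exact: integrableS.
have [N [w [iw cw]]] := L2_grid_sequence lu iu.
pose un n s := w n (grid (N n) s).
have [x xx] : exists x : nat -> E * E, forall n, in_generator S (x n).1 (x n).2 /\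
    `|x0 - (x n).1| <= n.+1%:R^-1.
  have H n : exists p : E * E, in_generator S p.1 p.2 /\ `|x0 - p.1| <= n.+1%:R^-1.
    have n0 : 0 < n.+1%:R^-1 :> R by rewrite invr_gt0.
    by have [x' [y' h]] := in_generator_dense P hS x0 n0; exists (x', y').
  by have [x xx] := choice H; exists x.
pose xn n := (x n).1.
have cxn : `|x0 - xn n| @[n --> \oo] --> (0 : R).
  apply: (@squeeze_cvgr _ _ _ _ (cst 0) (fun n => n.+1%:R^-1)).
  - by apply: nearW => n; rewrite normr_ge0 (xx n).2.
  - exact: cvg_cst.
  - exact: cvg_harmonic.
have lun n : step_limit mu `[0, t2]%classic (un n) by exact: step_limit_grid.
have cu := square_integrable_bochner_class lu iu.
have cun n : bochner_class mu `[0, t2]%classic (un n).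
  by split => //; exact: (grid_integrable (fun s => `|w n s|)).
pose dn n s := `|u s - un n s|.
have mdn n : measurable_fun (`[0, t2]%classic : set R) (dn n).
  by apply: (step_limit_norm (mu := mu)) => //; exact: step_limitB.
have dn0 n s : 0 <= dn n s by exact: normr_ge0.
have i1 : mu.-integrable `[0, t2]%classic (EFin \o (fun=> 1 : R)).
  exact: (@bounded_integrable _ _ _ mu _ _ `|1| mb (finite_segment 0 t2)).
have idn n : mu.-integrable `[0, t2]%classic (EFin \o (fun s => dn n s ^+ 2)).
  exact: iw.
have m1 : measurable_fun (`[0, t2]%classic : set R) (fun=> 1 : R) by [].
have i1' : mu.-integrable `[0, t2]%classic (EFin \o (fun=> 1 ^+ 2 : R)).
  by rewrite expr1n.
have p1 (s : R) : 0 <= 1 :> R by exact: ler01.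
have [idn1 cdn1] := @product_cvg0 _ _ _ mu _ dn (fun=> 1) mb dn0 p1
  mdn m1 idn i1' cw.
pose vn n := B \o un n; pose v := B \o u.
have cv : bochner_class mu `[0, t2]%classic v by exact: control_bochner_class.
have cvn n : bochner_class mu `[0, t2]%classic (vn n).
  exact: control_bochner_class.
have [X [cX XE]] : exists X : R -> E, continuous X /\
    forall t, 0 <= t -> t <= t2 -> X t = mild S v x0 t.
  exists (mild_ext S t2 v x0); split; first exact: (mild_ext_continuous P hS).
  by move=> t h1 h2; apply: (mild_extE P hS).
have [Xn Xn_spec] : exists Xn : nat -> R -> E, forall n, continuous (Xn n) /\
    forall t, 0 <= t -> t <= t2 -> Xn n t = mild S (vn n) (xn n) t.
  exists (fun n => mild_ext S t2 (vn n) (xn n)) => n.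
  split; first exact: (mild_ext_continuous P hS).
  by move=> t h1 h2; apply: (mild_extE P hS).
have cXn n : continuous (Xn n) by have [] := Xn_spec n.
have XnE n t : 0 <= t -> t <= t2 -> Xn n t = mild S (vn n) (xn n) t.
  by have [_] := Xn_spec n; exact.
have [M [M0 HM]] := Sg_bounded hS t2.
(* The trajectories converge uniformly on [0, t2], with the rate of [mild_norm]. *)
have [r cr rb] : exists2 r : nat -> R, r n @[n --> \oo] --> (0 : R) &
    forall n t, 0 <= t -> t <= t2 -> `|Xn n t - X t| <= r n.
  exists (fun n => M * `|x0 - xn n| +
    M * (`|MB| * \int[mu]_(s in `[0, t2]%classic) (dn n s * 1))).
    rewrite [X in _ --> X](_ : 0 = M * 0 + M * (`|MB| * 0)); last first.
      by rewrite !mulr0 addr0.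
    apply: cvgD; first by apply: cvgM => //; exact: cvg_cst.
    apply: cvgM; first exact: cvg_cst.
    by apply: cvgM => //; exact: cvg_cst.
  move=> n t h1 h2; rewrite distrC XE// XnE//.
  have := mild_norm P hS x0 (xn n) h1 h2 (ltW M0) HM cv (cvn n).
  move=> /le_trans; apply; rewrite lerD2l ler_wpM2l ?(ltW M0)//.
  rewrite -RintegralZl//; apply: le_Rintegral => //.
  - apply: (@le_integrable_real _ _ _ mu _ _ (fun s => `|MB| * (dn n s * 1))) => //.
    + apply: (step_limit_norm (mu := mu)) => //.
      by apply: step_limitB; [case: cv|case: (cvn n)].
    + move=> s _; rewrite normr_id -linearB mulr1 (le_trans (B_bounded _))//.
      by rewrite ler_wpM2r// ler_norm.
    + exact: integrable_realZ.
  - exact: integrable_realZ.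
  - move=> s _; rewrite -linearB mulr1 (le_trans (B_bounded _))//.
    by rewrite ler_wpM2r// ler_norm.
have Xcv t : 0 <= t -> t <= t2 -> Xn n t @[n --> \oo] --> X t.
  move=> h1 h2; apply/(subr_cvg0 (fun n => Xn n t) (X t)); apply: norm_cvg0.
  apply: (@squeeze_cvgr _ _ _ _ (cst 0) r) => //; last exact: cvg_cst.
  by apply: nearW => n; rewrite normr_ge0 rb.
(* All the trajectories stay in a fixed ball, on which [G] is bounded: this is
   the domination needed for the state cost. *)
have [K HK] : exists K, forall n t, 0 <= t -> t <= t2 ->
    `|Xn n t| <= K /\ `|X t| <= K.
  have [C HC] : exists C, forall n, r n <= C.
    have /cvg_seq_bounded[C [_ HC]] : cvgn r by apply/cvg_ex; exists 0.
    exists (C + 1) => n; rewrite (le_trans (ler_norm _))// (HC (C + 1))//.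
    by rewrite ltrDl.
  have [|c _ Hc] := @EVT_max R (fun t => `|X t|) 0 t2 t20.
    apply: continuous_subspaceT => t; apply: continuous_comp; first exact: cX.
    exact: norm_continuous.
  exists (`|X c| + C) => n t h1 h2.
  have h3 : `|X t| <= `|X c| by apply: Hc; rewrite in_itv/= h1.
  have C0 : 0 <= C by rewrite (le_trans (normr_ge0 (Xn n t - X t)))// (le_trans (rb n t h1 h2)).
  split; last by rewrite (le_trans h3)// lerDl.
  rewrite -[Xn n t](subrK (X t)) (le_trans (ler_normD _ _))// addrC lerD//.
  by rewrite (le_trans (rb n t h1 h2)).
have [c Hc] := G_bounded K.
have memt2 s : `[t1, t2]%classic s -> 0 <= s /\ s <= t2.
  by rewrite /= in_itv/= => /andP[h1 ->]; rewrite (le_trans t10).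
have iGX (Y : R -> E) : continuous Y ->
    mu.-integrable `[t1, t2]%classic (EFin \o (fun s => G (Y s))).
  move=> cY; apply: continuous_itv_integrable => s.
  by apply: continuous_comp; [exact: cY|exact: G_cont].
have cG : \int[mu]_(s in `[t1, t2]%classic) G (Xn n s) @[n --> \oo] -->
    \int[mu]_(s in `[t1, t2]%classic) G (X s).
  have [] // := @Rdominated_convergence _ _ _ mu _ (fun n s => G (Xn n s))
    (fun s => G (X s)) (fun=> c) m12.
  - by move=> n; exact: (integrable_measurable (iGX _ (cXn n))).
  - move=> s /memt2[h1 h2]; apply: continuous_cvg; first exact: G_cont.
    exact: Xcv.
  - exact: (@bounded_integrable _ _ _ mu _ _ `|c| m12 (finite_segment t1 t2)).
  - by move=> n s /memt2[h1 h2]; apply: Hc; have [] := HK n s h1 h2.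
have iLn n : mu.-integrable `[0, t2]%classic (EFin \o (fun s => L (un n s))).
  exact: (grid_integrable (fun s => L (w n s))).
have iL := quadratic_integrable lu iu.
have cLn : \int[mu]_(s in `[t1, t2]%classic) L (un n s) @[n --> \oo] -->
    \int[mu]_(s in `[t1, t2]%classic) L (u s).
  (* Since [`|un n s| <= `|u s| + dn n s], the growth condition on [L] bounds the
     difference of the control costs by [dn n s * psi s + dn n s ^+ 2], up to a
     constant factor. *)
  pose psi s := 1 + 2 * `|u s|.
  have psi0 s : 0 <= psi s by rewrite addr_ge0// mulr_ge0.
  have mu_ : measurable_fun (`[0, t2]%classic : set R) (fun s => `|u s|).
    exact: (@step_limit_norm _ _ _ mu _ _ _ mb lu).
  have mpsi : measurable_fun (`[0, t2]%classic : set R) psi.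
    by apply: measurable_funD => //; exact: measurable_funM.
  have ipsi : mu.-integrable `[0, t2]%classic (EFin \o (fun s => psi s ^+ 2)).
    apply: (@le_integrable_real _ _ _ mu _ _ (fun s => 2 + 8 * `|u s| ^+ 2)) => //.
    - exact: measurable_funX.
    - by move=> s _; rewrite ger0_norm ?sqr_ge0//; exact: sqr_affine_le.
    - apply: integrable_realD => //; last exact: integrable_realZ.
      exact: (@bounded_integrable _ _ _ mu _ _ `|2| mb (finite_segment 0 t2)).
  have [ip cp] := @product_cvg0 _ _ _ mu _ dn psi mb dn0 psi0 mdn mpsi idn ipsi cw.
  have bound n s : `|L (un n s) - L (u s)| <=
      `|cL| * (dn n s * psi s) + `|cL| * dn n s ^+ 2.
    have h1 : `|un n s| <= `|u s| + dn n s.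
      by rewrite -[un n s](subKr (u s)) (le_trans (ler_normB _ _)).
    rewrite distrC (le_trans (L_quadratic _ _))// -mulrDr.
    apply: (@le_trans _ _ (`|cL| * (dn n s * (1 + `|u s| + `|un n s|)))).
      by rewrite ler_wpM2r ?ler_norm// mulr_ge0// !addr_ge0.
    rewrite ler_wpM2l// expr2 -mulrDr ler_wpM2l// /psi.
    by rewrite mulr2n mulrDl mul1r addrA -[leRHS]addrA lerD2l.
  have ib n : mu.-integrable `[0, t2]%classic (EFin \o (fun s =>
      `|cL| * (dn n s * psi s) + `|cL| * dn n s ^+ 2)).
    by apply: integrable_realD => //; exact: integrable_realZ.
  have cb : `|cL| * \int[mu]_(s in `[0, t2]%classic) (dn n s * psi s) +
      `|cL| * \int[mu]_(s in `[0, t2]%classic) (dn n s ^+ 2)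
      @[n --> \oo] --> (0 : R).
    rewrite [X in _ --> X](_ : 0 = `|cL| * 0 + `|cL| * 0); last first.
      by rewrite !mulr0 addr0.
    by apply: cvgD; apply: cvgM => //; exact: cvg_cst.
  apply/(subr_cvg0 (fun n => \int[mu]_(s in `[t1, t2]%classic) L (un n s))
    (\int[mu]_(s in `[t1, t2]%classic) L (u s))); apply: norm_cvg0.
  apply: squeeze_cvgr cb; last exact: (cvg_cst 0).
  apply: nearW => n; rewrite normr_ge0/=.
  have iD : mu.-integrable `[0, t2]%classic
      (EFin \o (fun s => L (un n s) - L (u s))) by exact: integrable_realB.
  rewrite -RintegralB//; [|exact: intS..].
  apply: le_trans (@le_normr_Rintegral _ _ _ mu _ _ m12 (intS _ iD)) _.
  apply: (@le_trans _ _ (\int[mu]_(s in `[0, t2]%classic) `|L (un n s) - L (u s)|)).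
    rewrite (Rintegral_split t10 t12 (integrable_norm iD)) lerDr.
    by apply: Rintegral_ge0 => s _; exact: normr_ge0.
  rewrite -!RintegralZl// -RintegralD//; [|exact: integrable_realZ..].
  by apply: le_Rintegral => //; exact: integrable_norm.
have cV : continuous V by move=> y; exact: differentiable_continuous.
have VE t : 0 <= t -> t <= t2 -> V (Xn n t) @[n --> \oo] --> V (X t).
  by move=> h1 h2; apply: continuous_cvg; [exact: cV|exact: Xcv].
have ineq n : V (Xn n t2) - V (Xn n t1) <=
    \int[mu]_(s in `[t1, t2]%classic) G (Xn n s) +
    \int[mu]_(s in `[t1, t2]%classic) L (un n s).
  have := grid_dissipation P hS V_diff G_cont pre_diss (N n) (w n) (xx n).1 t10 t12.
  rewrite -!XnE//; move=> /le_trans; apply.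
  rewrite -RintegralD//; [|exact: iGX|exact: intS].
  rewrite le_eqVlt; apply/orP; left; apply/eqP.
  by apply: eq_Rintegral => s /set_mem/memt2[h1 h2]; rewrite XnE.
rewrite -/v -!XE//.
have -> : \int[mu]_(s in `[t1, t2]%classic) (G (mild S v x0 s) + L (u s)) =
    \int[mu]_(s in `[t1, t2]%classic) G (X s) +
    \int[mu]_(s in `[t1, t2]%classic) L (u s).
  rewrite -RintegralD//; [|exact: iGX|exact: intS].
  by apply: eq_Rintegral => s /set_mem/memt2[h1 h2]; rewrite XE.
apply: ler_cvg_to (cvgB (VE t2 t20 (lexx _)) (VE t1 t10 t12)) (cvgD cG cLn) _.
exact: nearW.
Qed.

(** Both sides of the inequality on [0, h] are computed up to [h * e] for small
    [h]: the left one by the chain rule at time 0, the right one by continuity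
    of [G] along the solution. *)
Lemma pointwise_dissipation (x y : E) (u : U) : in_generator S x y ->
  (forall h, 0 < h ->
    V (mild S (fun=> B u) x h) - V (mild S (fun=> B u) x 0) <=
    \int[mu]_(s in `[0, h]%classic) (G (mild S (fun=> B u) x s) + L u)) ->
  'd V x (y + B u) <= G x + L u.
Proof.
move=> gxy H; pose v := fun _ : R => B u.
have cv b : bochner_class mu `[0, b]%classic v by exact: const_bochner_class.
have [X cX XE] : exists2 X : R -> E, continuous X &
    forall t, 0 <= t -> t <= 1 -> X t = mild S v x t.
  exists (mild_ext S 1 v x); first exact: (mild_ext_continuous P hS).
  by move=> t h1 h2; apply: (mild_extE P hS).
have X0 : X 0 = x by rewrite XE// mild0.
have cGX : continuous (fun s => G (X s)).
  by move=> s; apply: continuous_comp; [exact: cX|exact: G_cont].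
apply/ler_addgt0Pr => e e0.
have e20 : 0 < e / 2 by rewrite divr_gt0.
have := @const_control_right _ _ P _ hS _ _ (B u) gxy.
move=> /(right_chain_rule (V_diff _)) /(_ e20).
have /cvgrPdist_le/(_ _ e20)/nbhs_ballP[d /= d0 Hd] := cGX 0.
rewrite X0 in Hd.
move=> near1; near (0 : R)^'+ => h.
have h0 : 0 < h by near: h; exact: nbhs_right_gt.
have h1 : h <= 1 by near: h; apply: nbhs_right_le.
have hd : h < d by near: h; exact: nbhs_right_lt.
have h0' := ltW h0.
have mX : Sg S h x + const_response S (B u) h = X h.
  by rewrite XE.
have : `|V (X h) - V x - h * 'd V x (y + B u)| <= h * (e / 2).
  by rewrite -mX; near: h; exact: near1.
rewrite ler_distlC => /andP[_].
have := H h h0; rewrite -/v -XE// -XE// X0.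
have -> : \int[mu]_(s in `[0, h]%classic) (G (mild S v x s) + L u) =
    \int[mu]_(s in `[0, h]%classic) (G (X s) + L u).
  apply: eq_Rintegral => s /set_mem; rewrite /= in_itv/= => /andP[s0 sh].
  by rewrite XE// (le_trans sh).
have : \int[mu]_(s in `[0, h]%classic) (G (X s) + L u) <= h * (G x + e / 2 + L u).
  rewrite -{2}[h]subr0 -Rintegral_cst_itv//; apply: le_Rintegral.
  - exact: measurable_segment.
  - apply: continuous_itv_integrable => s; apply: continuousD; first exact: cGX.
    exact: cvg_cst.
  - by apply: continuous_itv_integrable => s; exact: cvg_cst.
  - move=> s; rewrite /= in_itv/= => /andP[s0 sh]; rewrite lerD2r.
    have : `|G x - G (X s)| <= e / 2.
      by apply: Hd; rewrite /ball/= sub0r normrN ger0_norm// (le_lt_trans sh).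
    by rewrite distrC => /ler_normlW; rewrite lerBlDl.
move=> h2 h3 h4.
rewrite -(ler_pM2l h0).
have := le_trans h3 h2; move: h4; rewrite -/v.
move: (V _) (V x) ('d V _ _) (G x) (L u) => a b c p q h5 h6.
lra.
Unshelve. all: by end_near. Qed.

End general_control.

(** * Realification of Hilbert spaces and of the control system *)
Section realified_theory.
Variables (R : realType) (k : scalar_kind).

Lemma rnormE (E : normedModType (scalar_field R k)) (x : E) :
  `|x| = of_real k (rnorm x).
Proof. exact: ge0_real_part. Qed.

Lemma of_real_lt (a b : R) : (of_real k a < of_real k b) = (a < b).
Proof. by case: k => //=; rewrite ltcR. Qed.

Lemma of_real_gt0 (a : R) : 0 < a -> 0 < of_real k a.
Proof. by case: k => //=; rewrite ltcR. Qed.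

Lemma gt0_real_part (a : scalar_field R k) : 0 < a -> 0 < real_part a.
Proof. by case: k a => //= -[x y]; rewrite ltcE => /andP[]. Qed.

Lemma real_part_conjugate (a : scalar_field R k) :
  real_part (conjugate a) = real_part a.
Proof. by case: k a => //= -[]. Qed.

(** The norms of [E] and of its realification correspond to each other under the
    embedding of [R] in the scalars, so the two uniform structures have the same
    Cauchy filters and the same limits. *)
Lemma cauchy_realified (E : completeNormedModType (scalar_field R k))
    (F : set_system (realified E)) :
  ProperFilter F -> cauchy F -> cvg F.
Proof.
move=> FF cF.
have /cauchy_cvgP/cvg_ex[/= l Fl] : cauchy (F : set_system E).
  apply: cauchy_exP => e e0.
  have r0 := gt0_real_part e0.
  have /cauchyP/(_ _ r0)[x Fx] := cF.
  exists x; apply: filterS Fx => y; rewrite -!ball_normE /ball_/=.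
  by move=> h; rewrite [ltRHS](ge0_real_part (ltW e0)) rnormE of_real_lt.
apply: (cvgP (l : realified E)); apply/cvg_ballP => e e0.
have /cvg_ballP/(_ _ (of_real_gt0 e0)) := Fl.
apply: filterS => y; rewrite -!ball_normE /ball_/=.
by rewrite rnormE of_real_lt.
Qed.

HB.instance Definition _ (E : completeNormedModType (scalar_field R k)) :=
  Uniform_isComplete.Build (realified E) (@cauchy_realified E).

End realified_theory.
Section realified_hilbert.
Variables (R : realType) (k : scalar_kind).

Lemma realified_linear_proof (E F : normedModType (scalar_field R k))
    (L : {linear E -> F}) : linear (L : realified E -> realified F).
Proof. by move=> a x y; exact: (linearP L (of_real k a) x y). Qed.

Definition realified_linear (E F : normedModType (scalar_field R k))
    (L : {linear E -> F}) : {linear realified E -> realified F} :=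
  HB.pack (L : realified E -> realified F)
    (GRing.isLinear.Build _ _ _ _ _ (realified_linear_proof L)).

Definition realified_ip (H : hilbertType R k) (x y : realified H) : R :=
  real_part ((inner : {dot H for _}) x y).

Program Definition realified_inner_product (H : hilbertType R k) :
    real_inner_product (realified H) :=
  @RealInnerProduct _ _ (@realified_ip H) _ _ _ _.
Next Obligation.
by move=> H x y z; rewrite /realified_ip linearDl real_partD.
Qed.
Next Obligation.
move=> H a x y; rewrite /realified_ip -real_partM; congr real_part.
exact: (linearZl_LR (inner : {dot H for _}) y (of_real k a) x).
Qed.
Next Obligation.
move=> H x y; rewrite /realified_ip.
by rewrite hermitian_subproof expr0 mul1r real_part_conjugate.
Qed.
Next Obligation.
move=> H x; rewrite /realified_ip inner_norm rnormE expr2 -of_realM of_realK.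
by rewrite -expr2.
Qed.

Lemma realified_c0_semigroup (H : hilbertType R k) (S : R -> {linear H -> H}) :
  C0_semigroup S -> c0_semigroup (fun t => realified_linear (S t)).
Proof. by case=> h1 h2 h3 h4; split. Qed.

End realified_hilbert.

Section control_system.
Variables (R : realType) (k : scalar_kind) (H U : hilbertType R k).
Notation mu := (@lebesgue_measure R).

Lemma mild_solutionE (S : R -> {linear H -> H}) (B : {linear U -> H}) (x0 : H)
    (N : set R) (u : R -> U) (u' : R -> realified U) (t : R) :
  measurable N -> mu N = 0%E -> (forall s, 0 <= s -> ~ N s -> u s = u' s) ->
  0 <= t ->
  mild_solution S B x0 u t =
  mild (fun s => realified_linear (S s)) (realified_linear B \o u') x0 t.
Proof.
move=> mN N0 uu' t0; pose S' s := realified_linear (S s).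
have e1 : Sg S' t x0 = S t x0 by rewrite (SgE S' t0).
have e2 : bochner_integral (E := realified H) mu `[0, t]%classic
      (fun s => S (t - s) (B (u s))) =
    bochner_integral mu `[0, t]%classic
      (fun s => Sg S' (t - s) ((realified_linear B \o u') s)).
  apply: (@bochner_integral_off_null _ _ _ mu _ N _ _ _ mN N0) => s.
  rewrite /= in_itv/= => /andP[s0 st] Ns.
  have ts : 0 <= t - s by rewrite subr_ge0.
  have -> : (fun s => Sg S' (t - s) ((realified_linear B \o u') s)) s =
    S (t - s) (B (u' s)) by rewrite (SgE S' ts).
  by rewrite (uu' s s0 Ns).
rewrite /mild e1 -e2; exact: erefl.
Qed.

(** Off a null set [N], the control is a limit of step maps; replaced by 0 on [N],
    it becomes a limit everywhere. *)
Lemma L2_loc_representative (u : R -> U) : L2_loc u ->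
  exists (N : set R) (u' : R -> realified U),
  [/\ measurable N, mu N = 0%E, (forall s, 0 <= s -> ~ N s -> u s = u' s) &
   forall b, step_limit mu `[0, b]%classic u' /\
     mu.-integrable `[0, b]%classic (EFin \o (fun s => `|u' s| ^+ 2))].
Proof.
move=> [[s [N [mN N0 sN]]] ub].
have mQ : measurable (~` N) by exact: measurableC.
pose u' (t : R) : realified U := (\1_(~` N) t : R) *: (u t : realified U).
have uu' t : ~ N t -> u t = u' t.
  by move=> Nt; rewrite /u' indicE mem_set// scale1r.
exists N, u'; split => // [t _|b]; first exact: uu'.
have mb := measurable_segment 0 b.
have lu' : step_limit mu `[0, b]%classic u'.
  apply: step_limit_restrict => //; exists s => t [].
  rewrite /= in_itv/= => /andP[t0 tb] Nt.
  apply: contrapT => h; apply: Nt; apply: sN => /=.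
  by move=> /(_ _)/h; apply; rewrite in_itv/= t0.
split => //; apply: ge0_integrable => //.
- by apply: measurable_funX; exact: (@step_limit_norm _ _ _ mu _ _ _ mb lu').
- rewrite -(@integral_off_null _ _ _ mu N _ (fun t => ((rnorm (u t)) ^+ 2)%:E))//.
  by move=> t _ Nt; rewrite (uu' t Nt).
Qed.

Lemma L2_loc_const (u : U) : L2_loc (fun _ : R => u).
Proof.
split.
  have fb n : (mu `[0%R, n%:R]%classic < +oo)%E by exact: finite_segment.
  have mn n : measurable (`[0%R, n%:R]%classic : set R) by exact: measurable_segment.
  exists (fun n => @step_of _ _ _ mu (realified U) 'I_1 (fun=> `[0, n%:R]%classic)
    (fun=> u) (fun=> mn n) (fun=> fb n)).
  apply: aeW => t; rewrite /= in_itv/= andbT => t0.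
  apply: (@cvg_near_cst _ (realified U)); near=> n.
  rewrite step_ofE big_ord1 indicE mem_set ?scale1r//= in_itv/= t0/=.
  by near: n; exact: nbhs_infty_ger.
move=> b; rewrite integral_cst//=.
by rewrite lte_mul_pinfty// ?lee_fin ?sqr_ge0//; exact: finite_segment.
Unshelve. all: by end_near. Qed.

End control_system.

(** * The running cost and the dissipation rate *)
Section costs.
Variables (R : realType) (E F : normedModType R) (P : real_inner_product E).

Lemma classK_norm_continuous (alpha : R -> R) (xe : E) : classK alpha ->
  continuous (fun x : E => alpha `|x - xe|).
Proof.
case=> /subspace_continuousP calpha _ _ x; apply/cvgrPdist_le => e e0.
have : `[0, +oo[%classic `|x - xe| by rewrite /= in_itv/= normr_ge0.
move=> /calpha /cvgrPdist_le /(_ _ e0).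
rewrite near_withinE => /nbhs_ballP[d /= d0 Hd].
near=> y; apply: Hd; last by rewrite /= in_itv/= normr_ge0.
rewrite /ball/= (le_lt_trans (ler_dist_dist _ _))//.
rewrite opprB addrA subrK; near: y; exact: cvgr_dist_lt.
Unshelve. all: by end_near. Qed.

Lemma classK_bounded (alpha : R -> R) r s : classK alpha -> 0 <= r -> r <= s ->
  `|alpha r| <= alpha s.
Proof.
move=> [_ mono alpha0] r0 rs.
have mono' p q : 0 <= p -> p <= q -> alpha p <= alpha q.
  move=> p0; rewrite le_eqVlt => /predU1P[->//|pq].
  by apply/ltW/mono; rewrite ?in_itv/= ?andbT// (le_trans p0)// ltW.
by rewrite ger0_norm ?mono'// -alpha0 mono'.
Qed.

Variables (C : {linear E -> F}) (MC : R).
Hypothesis C_bounded : forall x, `|C x| <= MC * `|x|.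

Lemma state_cost_continuous (alpha : R -> R) (z xe : E) (c : R) : classK alpha ->
  continuous (fun x : E => `|C x| ^+ 2 + 2 * P z x - c - alpha `|x - xe|).
Proof.
move=> hK x; apply: cvgB; last exact: classK_norm_continuous.
apply: cvgB; last exact: cvg_cst.
apply: cvgD.
  apply: (@continuous_cvg _ _ _ _ _ _ (fun r : R => r ^+ 2)).
    exact: exprn_continuous.
  apply: cvg_norm; exact: (bounded_linear_continuous C_bounded).
apply: cvgM; [exact: cvg_cst|exact: ip_continuous].
Qed.

Lemma state_cost_bounded (alpha : R -> R) (z xe : E) (c : R) : classK alpha ->
  forall r, exists b, forall x : E, `|x| <= r ->
    `| `|C x| ^+ 2 + 2 * P z x - c - alpha `|x - xe| | <= b.
Proof.
move=> hK r.
exists ((`|MC| * `|r|) ^+ 2 + 2 * (`|z| * `|r|) + `|c| + alpha (r + `|xe|)) => x xr.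
have xr' : `|x| <= `|r| by rewrite (le_trans xr)// ler_norm.
have h1 : `|C x| ^+ 2 <= (`|MC| * `|r|) ^+ 2.
  rewrite ler_pXn2r ?nnegrE ?mulr_ge0// (le_trans (C_bounded _))//.
  rewrite (@le_trans _ _ (`|MC| * `|x|))//; first by rewrite ler_wpM2r ?ler_norm.
  by rewrite ler_wpM2l.
have h2 : `|P z x| <= `|z| * `|r|.
  by rewrite (le_trans (norm_ip_le _ _ _))// ler_wpM2l.
have h3 : `|alpha `|x - xe| | <= alpha (r + `|xe|).
  by apply: classK_bounded => //; rewrite (le_trans (ler_normB _ _))// lerD2r.
rewrite (le_trans (ler_normB _ _))// lerD//.
rewrite (le_trans (ler_normB _ _))// lerD2r.
rewrite (le_trans (ler_normD _ _))// normrX normr_id lerD//.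
by rewrite normrM ger0_norm// ler_pM2l.
Qed.

(** The growth condition on the control cost which yields its continuity on L2. *)
Lemma control_cost_quadratic (v u u' : E) :
  `|(`|C u| ^+ 2 + 2 * P v u) - (`|C u'| ^+ 2 + 2 * P v u')| <=
  (MC ^+ 2 + 2 * `|v|) * (`|u - u'| * (1 + `|u| + `|u'|)).
Proof.
have dC : `| `|C u| - `|C u'| | <= MC * `|u - u'|.
  by rewrite (le_trans (ler_dist_dist _ _))// -linearB.
have M0 : 0 <= MC * `|u - u'| by rewrite (le_trans _ dC).
have h1 : `| `|C u| ^+ 2 - `|C u'| ^+ 2 | <=
    MC * `|u - u'| * (MC * (`|u| + `|u'|)).
  rewrite subr_sqr normrM ler_pM// ger0_norm ?addr_ge0//.
  by rewrite mulrDr lerD.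
have h2 : `|P v (u - u')| <= `|v| * `|u - u'| by exact: norm_ip_le.
have -> : (`|C u| ^+ 2 + 2 * P v u) - (`|C u'| ^+ 2 + 2 * P v u') =
    (`|C u| ^+ 2 - `|C u'| ^+ 2) + 2 * P v (u - u').
  by rewrite ipBr; ring.
rewrite (le_trans (ler_normD _ _))// normrM [`|2|]ger0_norm//.
apply: (@le_trans _ _ (MC * `|u - u'| * (MC * (`|u| + `|u'|)) +
    2 * (`|v| * `|u - u'|))); first by rewrite lerD// ler_pM2l.
have [a0 b0 c0 d0] : [/\ 0 <= `|u - u'|, 0 <= `|u|, 0 <= `|u'| & 0 <= `|v|] by [].
move: `|u - u'| `|u| `|u'| `|v| a0 b0 c0 d0 => {h1 h2 dC M0} a b c d a0 b0 c0 d0.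
have e1 : 0 <= MC ^+ 2 * a by rewrite mulr_ge0// sqr_ge0.
have e2 : 0 <= d * a * (b + c) by rewrite !mulr_ge0// addr_ge0.
rewrite (_ : (MC ^+ 2 + 2 * d) * (a * (1 + b + c)) =
  (MC * a * (MC * (b + c)) + 2 * (d * a)) + (MC ^+ 2 * a + 2 * (d * a * (b + c)))).
  by rewrite lerDl addr_ge0// mulr_ge0.
by ring.
Qed.

End costs.

(** * The equivalence *)
Section generator_domain.
Variables (R : realType) (k : scalar_kind) (H : hilbertType R k).
Variables (S : R -> {linear H -> H}) (domA : set H) (A : H -> H).
Hypothesis A_generates : generates domA A S.
Let S' t := realified_linear (S t).

Lemma in_generator_quotient (x y : realified H) :
  in_generator S' x y <-> difference_quotient S x t @[t --> 0^'+] --> y.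
Proof.
have E : \forall h \near (0 : R)^'+,
    h^-1 *: (Sg S' h x - x) = difference_quotient S x h.
  by near=> h; rewrite SgE//; near: h; exact: nbhs_right_ge.
split; apply: cvg_trans; apply: near_eq_cvg => //.
by apply: filterS E => h ->.
Unshelve. all: by end_near. Qed.

Lemma domA_in_generator x : domA x -> in_generator S' (x : realified H) (A x : realified H).
Proof. by move=> /(A_generates.2 x) h; apply/in_generator_quotient. Qed.

Lemma in_generator_domA (x y : realified H) : in_generator S' x y -> domA x /\ y = A x.
Proof.
move=> /in_generator_quotient g.
have dx : domA x by rewrite A_generates.1 /=; exact: cvgP g.
split => //.
exact: (@cvg_unique (realified H) (@norm_hausdorff _ _) _ _ _ _ g (A_generates.2 x dx)).
Qed.

End generator_domain.

Theorem lemma3 (R : realType) (k : scalar_kind) (H U Y Z : hilbertType R k)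
    (domA : set H) (A : H -> H) (S : R -> {linear H -> H})
    (B : {linear U -> H}) (C : {linear H -> Y}) (K : {linear U -> Z})
    (z : H) (v : U)
    (S_semigroup : C0_semigroup S) (A_generates : generates domA A S)
    (B_bounded : bounded_operator B) (C_bounded : bounded_operator C)
    (K_bounded : bounded_operator K)
    (K_coercive : exists2 cK : R,
       0 < cK & forall u : U, cK * rnorm (B u) <= rnorm (K u))
    (xe : H) (ue : U) (equilibrium : controlled_equilibrium domA A B xe ue)
    (V : realified H -> R) (V_storage : storage_function V)
    (alpha : R -> R) (alpha_classK : classK alpha) :
  let l := running_cost C K z v in
  let x_ u x0 := mild_solution S B x0 u in
  strictly_pre_dissipative domA A B l xe ue V alpha <->
  forall (x0 : H) (u : R -> U), L2_loc u ->
  forall t1 t2 : R, 0 <= t1 -> t1 < t2 ->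
    V (x_ u x0 t2) - V (x_ u x0 t1) <=
    \int[lebesgue_measure]_(t in `[t1, t2])
      (l (x_ u x0 t) (u t) - l xe ue - alpha (rnorm (x_ u x0 t - xe))).
Proof.
move=> l x_.
have hS := realified_c0_semigroup S_semigroup.
pose S' t := realified_linear (S t).
pose B' := realified_linear B; pose C' := realified_linear C.
pose K' := realified_linear K.
have [MB HB] : exists M, forall w, `|B' w| <= M * `|w| by exact: B_bounded.
have [MC HC] : exists M, forall x, `|C' x| <= M * `|x| by exact: C_bounded.
have [MK HK] : exists M, forall w, `|K' w| <= M * `|w| by exact: K_bounded.
pose P := realified_inner_product H; pose Q := realified_inner_product U.
pose G (x : realified H) : R := `|C' x| ^+ 2 + 2 * P (z : realified H) x
  - l xe ue - alpha `|x - (xe : realified H)|.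
pose L (u : realified U) : R := `|K' u| ^+ 2 + 2 * Q (v : realified U) u.
have lE x u : l x u - l xe ue - alpha (rnorm (x - xe)) = G x + L u.
  have aux (p q r s c a : R) :
      p + q + 2 * r + 2 * s - c - a = (p + 2 * r - c - a) + (q + 2 * s) by ring.
  exact: aux.
have V_diff := V_storage.1.
have G_cont : continuous G.
  exact: (@state_cost_continuous _ _ _ P C' MC HC alpha z xe (l xe ue) alpha_classK).
have G_bdd r : exists b, forall x, `|x| <= r -> `|G x| <= b.
  exact: (state_cost_bounded P HC z xe (l xe ue) alpha_classK r).
have L_quad := control_cost_quadratic Q HK (v : realified U).
split=> [diss x0 u Lu t1 t2 t10 t12|ineq x u dx].
- have [N [u' [mN N0 uu' u'P]]] := L2_loc_representative Lu.
  have [lu' iu'] := u'P t2.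
  have t20 : 0 <= t2 by rewrite (le_trans t10)// ltW.
  have XE t : 0 <= t -> x_ u x0 t = mild S' (B' \o u') x0 t.
    by move=> t0; exact: mild_solutionE mN N0 uu' t0.
  have pd x y w : in_generator S' x y -> 'd V x (y + B' w) <= G x + L w.
    move=> /(in_generator_domA A_generates)[dx ->]; rewrite -lE; exact: diss.
  have := L2_dissipation P hS HB V_diff G_cont G_bdd L_quad pd x0 t10
    (ltW t12) lu' iu'.
  rewrite -XE// -XE// => /le_trans; apply.
  rewrite le_eqVlt; apply/orP; left; apply/eqP; congr fine.
  apply: (@integral_off_null _ _ _ lebesgue_measure N) => // s.
  rewrite /= in_itv/= => /andP[s1 s2] Ns; have s0 := le_trans t10 s1.
  by rewrite -XE// -(uu' s s0 Ns) lE.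
- rewrite lE.
  have := @pointwise_dissipation _ _ P _ hS _ B' V G L V_diff G_cont x (A x) u
    (domA_in_generator A_generates dx).
  apply.
  move=> h h0.
  have XE t : 0 <= t -> x_ (fun=> u) x t = mild S' (fun=> B' u) x t.
    exact: (@mild_solutionE _ _ _ _ S B x set0 (fun=> u) (fun=> u) t measurable0
      (measure0 _) (fun _ _ _ => erefl)).
  rewrite -(XE h (ltW h0)) -(XE 0 (lexx 0)).
  have := ineq x _ (L2_loc_const u) 0 h (lexx 0) h0.
  move=> /le_trans; apply; rewrite le_eqVlt; apply/orP; left; apply/eqP.
  apply: eq_Rintegral => s /set_mem; rewrite /= in_itv/= => /andP[s0 _].
  by rewrite -(XE s s0) lE.
Qed.
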